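(* Let $A\in\mathcal{L}(X,Y)$, let $y=Ax+\varepsilon$, where $x$ is a square-integrable $X$-valued random variable and $\varepsilon$ is a zero-mean square-integrable $Y$-valued random variable, independent of $x$, with injective covariance operator $\Sigma_\varepsilon$, and let $\rho$ be the joint distribution of $(x,y)$. Assume that the compatibility assumption between $\Sigma_\varepsilon$ and $A$ holds, that $\mathcal{B}\subset\mathcal{L}(\ell^2,X)$ is a nonempty compact set such that $AB$ is finite basis injective for every $B\in\mathcal{B}$, and that there exists $Q_0>0$ such that $\|x\|_X\le Q_0$ and $\|\varepsilon\|_Y\le Q_0$ almost surely. Let $\mathbf{z}=\{(x_j,y_j)\}_{j=1}^m$ be i.i.d. samples from $\rho$. Then there exist a minimizer $B^\star$ of the expected loss $L$ over $\mathcal{B}$ and, with probability $1$, a minimizer $\widehat B$ of the empirical loss $\widehat L$ over $\mathcal{B}$. Furthermore, there exist constants $C,C'>0$, depending only on $A$, $\Sigma_\varepsilon$, $Q_0$ and $\mathcal{B}$, such that for all $\eta>0$, $$\mathbb{P}_{\mathbf{z}\sim\rho^m}\left[L(\widehat B)-L(B^\star)\le\eta\right]\ge 1-2\,\mathcal{N}(\mathcal{B},C\eta)\,e^{-C'm\eta^2}.$$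
   Context: $X,Y$ are real separable Hilbert spaces; $\mathcal{L}(\cdot,\cdot)$ denotes bounded linear operators with the operator norm (compactness of $\mathcal{B}$ is with respect to this norm); $\ell^2=\ell^2(\mathbb{N})$ with $\mathbb{N}=\{1,2,\dots\}$ and canonical basis $(e_i)$. $\Sigma_\varepsilon^{-1}$ and $\Sigma_\varepsilon^{-1/2}$ denote the (possibly unbounded) inverses of $\Sigma_\varepsilon$ and $\Sigma_\varepsilon^{1/2}$, defined on $\operatorname{Im}(\Sigma_\varepsilon)$ and $\operatorname{Im}(\Sigma_\varepsilon^{1/2})$ respectively. Compatibility assumption: $\operatorname{Im}(A)\subset\operatorname{Im}(\Sigma_\varepsilon)$ and $\Sigma_\varepsilon^{-1}A\colon X\to Y$ is a compact operator. Finite basis injectivity of $AB$: for every finite $I\subset\mathbb{N}$, the restriction of $AB$ to $\ell^2_I:=\operatorname{span}\{e_i:i\in I\}$ is injective. Reconstruction map: $R_B(y)=B\hat u_B(y)$, where $\hat u_B(y)\in\ell^2$ is the unique minimizer over $u\in\ell^2$ of $\frac12\|\Sigma_\varepsilon^{-1/2}ABu\|_Y^2-\langle y,\Sigma_\varepsilon^{-1}ABu\rangle_Y+\|u\|_{\ell^1}$ (with $\|u\|_{\ell^1}=+\infty$ for $u\in\ell^2\setminus\ell^1$); existence and uniqueness hold for every $y\in Y$ and every $B\in\mathcal{L}(\ell^2,X)$ such that $AB$ is finite basis injective, whenever $A\in\mathcal{L}(X,Y)$, $\Sigma_\varepsilon$ is the injective covariance operator of a zero-mean square-integrable $Y$-valued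 random variable, $\operatorname{Im}(A)\subset\operatorname{Im}(\Sigma_\varepsilon)$ and $\Sigma_\varepsilon^{-1}A\colon X\to Y$ is compact. Losses: $L(B)=\mathbb{E}_{(x,y)\sim\rho}\big[\|R_B(y)-x\|_X^2\big]$ and $\widehat L(B)=\frac1m\sum_{j=1}^m\|R_B(y_j)-x_j\|_X^2$. The minimizer $\widehat B$ depends on the sample $\mathbf{z}$ and is thus random. Covering number: for $r>0$, $\mathcal{N}(\mathcal{B},r)$ is the minimum number of balls of radius $r$ (in the operator norm of $\mathcal{L}(\ell^2,X)$) whose union contains $\mathcal{B}$. *)

(* Defs.v *)
From HB Require Import structures.
From mathcomp Require Import all_boot all_order all_algebra sesquilinear finmap.
From mathcomp Require Import all_classical all_reals all_analysis.

Set Implicit Arguments.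
Unset Strict Implicit.
Unset Printing Implicit Defensive.

Import Order.TTheory GRing.Theory Num.Theory.
Import numFieldNormedType.Exports.

Local Open Scope classical_set_scope.
Local Open Scope ring_scope.

HB.mixin Record NormedModule_isHilbert (R : realType) V
    & CompleteNormedModule R V := {
  dotp : {dot V for idfun} ;
  dotp_norm : forall u : V, dotp u u = `|u| ^+ 2 }.

#[short(type=hilbertType)]
HB.structure Definition Hilbert (R : realType) :=
  {V of NormedModule_isHilbert R V & CompleteNormedModule R V}.

Definition separable (T : topologicalType) : Prop :=
  exists2 D : set T, countable D & dense D.

HB.mixin Record isBoundedOp (R : realType) (U V : normedModType R)
    (f : U -> V) := {
  bounded_op : exists M, forall x, `|f x| <= M * `|x| }.

#[short(type=boundedLinear)]
HB.structure Definition BoundedLinear (R : realType) (U V : normedModType R) :=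
  {f of isBoundedOp R U V f & @GRing.Linear R U V *:%R f}.

Notation "''L' ( U , V )" := (boundedLinear U V)
  (at level 8, U, V at level 99, format "''L' ( U ,  V )") : type_scope.

Section bounded_linear.
Context (R : realType) (U V : normedModType R).

Definition bounded_linear : {pred U -> V} :=
  mem [set f | linear f /\ exists M, forall x, `|f x| <= M * `|x|].

Section Sub.
Context (f : U -> V) (fP : f \in bounded_linear).
Let fP' := set_mem fP.
Definition bounded_linear_Sub1 := @GRing.isLinear.Build R U V *:%R f fP'.1.
#[local] HB.instance Definition _ := bounded_linear_Sub1.
Definition bounded_linear_Sub2 := @isBoundedOp.Build R U V f fP'.2.
#[local] HB.instance Definition _ := bounded_linear_Sub2.
Definition bounded_linear_Sub := [the boundedLinear U V of f].
End Sub.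

Lemma bounded_linearP (f : 'L(U, V)) : (f : U -> V) \in bounded_linear.
Proof.
by apply/mem_set; split; [exact: linearP|exact: bounded_op].
Qed.

Lemma bounded_linear_eqP (f g : 'L(U, V)) : f = g <-> f =1 g.
Proof.
split=> [->//|/funext]; case: f g => [f cf] [g cg] /= fg.
case: _ / fg in cg *; congr BoundedLinear.Pack.
case: cf cg => [[l1 ] [l2] [l3]] [[k1] [k2] [k3]].
by rewrite (Prop_irrelevance l1 k1) (Prop_irrelevance l2 k2)
           (Prop_irrelevance l3 k3).
Qed.

Lemma bounded_linear_rect (K : 'L(U, V) -> Type) :
  (forall f (Pf : f \in bounded_linear), K (bounded_linear_Sub Pf)) ->
  forall u, K u.
Proof.
move=> Ksub u; rewrite (_ : u = bounded_linear_Sub (bounded_linearP u)) //.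
exact/bounded_linear_eqP.
Qed.

Lemma bounded_linear_valP f (Pf : f \in bounded_linear) :
  bounded_linear_Sub Pf = f :> (_ -> _).
Proof. by []. Qed.

HB.instance Definition _ :=
  isSub.Build _ _ 'L(U, V) bounded_linear_rect bounded_linear_valP.

HB.instance Definition _ := gen_eqMixin 'L(U, V).
HB.instance Definition _ := gen_choiceMixin 'L(U, V).

Lemma bounded_linear_submod_closed : submod_closed bounded_linear.
Proof.
split.
  apply/mem_set; split=> [a x y|].
    by rewrite -[LHS]/(0 : V) -[RHS]/(a *: (0 : V) + 0) scaler0 addr0.
  by exists 0 => x; rewrite -[X in `|X|]/(0 : V) normr0 mul0r.
move=> a f g /set_mem[lf [M fM]] /set_mem[lg [N gN]]; apply/mem_set; split.
  move=> b x y.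
  rewrite -[LHS]/(a *: f (b *: x + y) + g (b *: x + y)).
  rewrite -[RHS]/(b *: (a *: f x + g x) + (a *: f y + g y)).
  by rewrite lf lg !scalerDr !scalerA addrACA (mulrC b).
exists (`|a| * M + N) => x; rewrite -[X in `|X| <= _]/(a *: f x + g x).
rewrite (le_trans (ler_normD _ _))//.
by rewrite normrZ mulrDl lerD// -mulrA ler_wpM2l.
Qed.

HB.instance Definition _ :=
  GRing.isSubmodClosed.Build _ _ bounded_linear bounded_linear_submod_closed.

HB.instance Definition _ := [SubChoice_isSubLmodule of 'L(U, V) by <:].

Definition opnorm (f : 'L(U, V)) : R :=
  sup [set `|f x| | x in [set x : U | `|x| <= 1]].

Let opnorm_has_sup (f : 'L(U, V)) :
  has_sup [set `|f x| | x in [set x : U | `|x| <= 1]].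
Proof.
split; first by exists `|f 0|, 0 => //=; rewrite normr0.
have [M fM] := @bounded_op R U V f; exists `|M| => _ [x /= x1 <-].
rewrite (le_trans (fM x))// (le_trans (ler_norm _))// normrM normr_id.
by rewrite ler_piMr.
Qed.

Lemma opnorm_ub (f : 'L(U, V)) x : `|x| <= 1 -> `|f x| <= opnorm f.
Proof. by move=> x1; apply: ub_le_sup; [case: (opnorm_has_sup f)|exists x]. Qed.

Lemma opnorm_le (f : 'L(U, V)) M :
  (forall x, `|x| <= 1 -> `|f x| <= M) -> opnorm f <= M.
Proof.
move=> fM; apply: ge_sup; first by case: (opnorm_has_sup f).
by move=> _ [x /= x1 <-]; exact: fM.
Qed.

Lemma opnorm_ge0 f : 0 <= opnorm f.
Proof. by rewrite (le_trans (normr_ge0 (f 0)))// opnorm_ub// normr0. Qed.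

Lemma ler_opnormD f g : opnorm (f + g) <= opnorm f + opnorm g.
Proof.
apply: opnorm_le => x x1.
by rewrite (le_trans (ler_normD _ _))// lerD// opnorm_ub.
Qed.

Let opnormZ_le a f : opnorm (a *: f) <= `|a| * opnorm f.
Proof.
apply: opnorm_le => x x1.
by rewrite [X in X <= _](_ : _ = `|a| * `|f x|) ?ler_wpM2l ?opnorm_ub -?normrZ.
Qed.

Lemma opnormZ a f : opnorm (a *: f) = `|a| * opnorm f.
Proof.
have [->|a0] := eqVneq a 0.
  rewrite scale0r normr0 mul0r; apply/eqP; rewrite eq_le opnorm_ge0 andbT.
  by apply: opnorm_le => x _; rewrite normr0.
apply/eqP; rewrite eq_le opnormZ_le/=.
rewrite -{1}(scale1r f) -(mulVf a0) -scalerA -ler_pdivlMl ?normr_gt0//.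
by rewrite -normfV opnormZ_le.
Qed.

Lemma opnorm_eq0 f : opnorm f = 0 -> f = 0.
Proof.
move=> f0; apply/bounded_linear_eqP => x; apply/eqP; rewrite -normr_le0.
have [->|x0] := eqVneq x 0; first by rewrite linear0 normr0.
have := @opnorm_ub f (`|x|^-1 *: x).
rewrite normfZV// lexx f0 linearZ/= normrZ => /(_ isT).
by rewrite pmulr_rle0// normr_gt0 invr_eq0 normr_eq0.
Qed.

HB.instance Definition _ :=
  @Lmodule_isNormed.Build R 'L(U, V) opnorm ler_opnormD opnormZ opnorm_eq0.

End bounded_linear.

Lemma opnormE (R : realType) (U V : normedModType R) (f : 'L(U, V)) :
  `|f| = opnorm f.
Proof. by []. Qed.

(* Coordinates are indexed from 0 rather than from 1. *)
Definition l2 (R : realType) : Type := LfunType (@counting nat R) (lee1n 2).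

Section l2.
Context (R : realType).

HB.instance Definition _ := GRing.Lmodule.on (l2 R).

Definition l2norm (u : l2 R) : R := fine 'N[counting]_2[EFin \o u]%E.

Lemma ler_l2normD u v : l2norm (u + v) <= l2norm u + l2norm v.
Proof. exact: ler_LnormD. Qed.

Lemma l2normZ a u : l2norm (a *: u) = `|a| * l2norm u.
Proof.
by apply: EFin_inj; rewrite EFinM /l2norm !finite_norm_fine; exact: LnormZ.
Qed.

Lemma l2norm_eq0 u : l2norm u = 0 -> u = 0.
Proof.
move=> /fine_Lnormr_eq0 [N [_ N0 uN]]; apply/LfuneqP => i.
apply: contrapT => ui.
have Ni : N i by apply: uN => /= /(_ I).
have : (1 <= @counting nat R N)%E.
  rewrite /counting; case: ifPn => [/asboolP fN|_]; last by rewrite leey.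
  rewrite lee_fin ler1n cardfs_gt0; apply/negP => /eqP N00.
  by have := Ni; rewrite -(fset_setK fN) N00.
by rewrite N0 lee_fin ler10.
Qed.

HB.instance Definition _ :=
  @Lmodule_isNormed.Build R (l2 R) l2norm ler_l2normD l2normZ l2norm_eq0.

Lemma l2_basis_subproof (i : nat) :
  (fun j => (j == i)%:R : R) \in Lfun (@counting nat R) 2%:E.
Proof.
rewrite inE; apply/andP; split; first by rewrite inE.
rewrite inE /= /finite_norm Lnorm_counting// (@nneseriesD1 _ _ i)//; last first.
  by move=> k _; exact: poweR_ge0.
rewrite eseries0 ?adde0; last first.
  by move=> k _ /andP[_ /negbTE ki]; rewrite /= ki /= normr0 powR0.
by rewrite /= ltry.
Qed.

Definition l2_basis (i : nat) : l2 R := Lfun_Sub (lee1n 2) (l2_basis_subproof i).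

Definition l2_span (I : {fset nat}) : set (l2 R) :=
  [set u | exists c : nat -> R, u = \sum_(i <- I) c i *: l2_basis i].

Definition l1norm (u : l2 R) : \bar R := 'N[counting]_1[EFin \o u]%E.

End l2.

Section operators.
Context (R : realType).

Definition compact_operator (U V : normedModType R) (f : U -> V) : Prop :=
  linear f /\ forall D : set U, bounded_set D -> precompact (f @` D).

Definition finite_basis_injective (V : normedModType R) (f : l2 R -> V) : Prop :=
  forall I : {fset nat}, set_inj (l2_span I) f.

(* For injective f this is f^-1 on the range of f; off the range it is 0. *)
Definition inv_op (U V : normedModType R) (f : U -> V) (v : V) : U :=
  xget 0 [set u | f u = v].

(* A positive self-adjoint S has exactly one positive self-adjoint square
   root. *)
Definition sqrt_op (Y : hilbertType R) (S : 'L(Y, Y)) : 'L(Y, Y) :=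
  xget 0 [set Q : 'L(Y, Y) |
    [/\ (forall u v, dotp (Q u) v = dotp u (Q v)),
        (forall u, 0 <= dotp (Q u) u)
      & (forall u, Q (Q u) = S u)]].

Definition argmin (T : Type) (d : Order.disp_t) (K : porderType d)
    (D : set T) (f : T -> K) : set T :=
  [set a | D a /\ forall b, D b -> (f a <= f b)%O].

(* Open balls, with centres anywhere in V; the infimum over the empty set
   is +oo. *)
Definition covering_number (V : pseudoMetricType R) (D : set V) (r : R) : \bar R :=
  ereal_inf [set n%:R%:E | n in [set n : nat |
    exists c : 'I_n -> V, D `<=` \bigcup_j ball (c j) r]].

End operators.

Section probability.
Context (R : realType).

Definition has_law d d' (Om : measurableType d) (E : measurableType d')
    (P : probability Om R) (Z : Om -> E) (mu : probability E R) : Prop :=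
  forall D, measurable D -> pushforward P Z D = mu D.

Definition independent_RV d d1 d2 (Om : measurableType d)
    (E1 : measurableType d1) (E2 : measurableType d2) (P : probability Om R)
    (Z1 : {RV P >-> E1}) (Z2 : {RV P >-> E2}) : Prop :=
  forall D1 D2, measurable D1 -> measurable D2 ->
    P (Z1 @^-1` D1 `&` Z2 @^-1` D2) = (P (Z1 @^-1` D1) * P (Z2 @^-1` D2))%E.

Definition iid_sample d d' (Om : measurableType d) (E : measurableType d')
    (P : probability Om R) (m : nat) (Z : 'I_m -> {RV P >-> E})
    (mu : probability E R) : Prop :=
  (forall j, has_law P (Z j) mu) /\
  forall D : 'I_m -> set E, (forall j, measurable (D j)) ->
    P (\bigcap_j (Z j @^-1` D j)) = (\prod_(j < m) P (Z j @^-1` D j))%E.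

(* D is not assumed measurable: its inner probability is at least p. For
   measurable D this is p <= P D. *)
Definition prob_ge d (Om : measurableType d) (P : probability Om R)
    (D : set Om) (p : \bar R) : Prop :=
  exists2 F, measurable F /\ F `<=` D & (p <= P F)%E.

End probability.

Notation borel T := (g_sigma_algebraType (@open T)).

Section hilbert_random_variables.
Context (R : realType) (H : hilbertType R) (d : measure_display)
  (Om : measurableType d) (P : probability Om R) (Z : {RV P >-> borel H}).

Definition square_integrable : Prop :=
  P.-integrable [set: Om] (fun w => (`|Z w : H| ^+ 2)%:E).

(* Both the mean and the covariance operator are taken in the weak sense, by
   testing against vectors; no Hilbert-valued integral is involved. *)
Definition zero_mean : Prop := 
  forall v : H, ('E_P[fun w => dotp (Z w : H) v] = 0)%E.

Definition is_covariance_operator (S : 'L(H, H)) : Prop :=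
  forall u v, (dotp (S u) v)%:E =
    covariance P (fun w => dotp (Z w : H) u) (fun w => dotp (Z w : H) v).

End hilbert_random_variables.

Section reconstruction.
Context (R : realType) (X Y : hilbertType R) (A : 'L(X, Y)) (S : 'L(Y, Y)).

Definition compatible : Prop :=
  range A `<=` range S /\ compact_operator (fun x => inv_op S (A x)).

Definition objective (B : 'L(l2 R, X)) (y : Y) (u : l2 R) : \bar R :=
  ((2^-1 * `|inv_op (sqrt_op S) (A (B u))| ^+ 2
    - dotp y (inv_op S (A (B u))))%:E + l1norm u)%E.

(* The default value 0 of xget is only reached when there is no minimizer. *)
Definition reconstruct (B : 'L(l2 R, X)) (y : Y) : X :=
  B (xget 0 (argmin [set: l2 R] (objective B y))).

Definition sq_error (B : 'L(l2 R, X)) (z : borel X * borel Y) : R :=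
  `|reconstruct B z.2 - z.1| ^+ 2.

Definition expected_loss (rho : probability (borel X * borel Y)%type R)
    (B : 'L(l2 R, X)) : \bar R := 'E_rho[sq_error B]%E.

Definition empirical_loss m (z : 'I_m -> borel X * borel Y)
    (B : 'L(l2 R, X)) : R :=
  m%:R^-1 * \sum_(j < m) sq_error B (z j).

End reconstruction.

(* Main.v *)
(** Let K = Sigma^-1 A, which is compact, and let Q be the square root of Sigma.
    The objective is then |Q K B u|^2 / 2 - <y, K B u> + |u|_1.  Compactness of K
    and of BB makes K B e_i small for large i, uniformly in B, so for B in BB
    and |y| <= r the minimizers are bounded and supported on a common finite set
    of coordinates.  On that finite-dimensional space finite basis injectivity
    and compactness of BB give a uniform quadratic growth at the minimizer, hence
    the minimizer is Lipschitz in (B, y).  The squared error is therefore bounded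
    and Lipschitz in B on the almost sure range of the data, and the bound follows
    from Hoeffding's inequality at the centres of a covering of BB. *)

Require Import Defs.
From mathcomp Require Import all_boot all_order all_algebra finmap.
From mathcomp Require Import all_classical all_reals all_analysis.
From mathcomp Require Import measurable_realfun.
From mathcomp Require Import ring lra.

Set Implicit Arguments.
Unset Strict Implicit.
Unset Printing Implicit Defensive.

Import Order.TTheory GRing.Theory Num.Theory.
Import numFieldNormedType.Exports.

Local Open Scope classical_set_scope.
Local Open Scope ring_scope.

(** * Inner products and bounded operators *)

(** The linear term is the obstacle: [y] need not lie in the range of [Q], so the square cannot be
    completed and a lower bound for the objective is not obvious. Since [Sigma] is injective, the
    powers of [1 - Sigma / c] tend to 0; this splits [y] into a part in the range of [Sigma], paid
    for by the quadratic term, and a remainder, paid for by half of the l^1 norm. The order of the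
    choices matters: the resulting bound on the minimizers does not depend on how many coordinates
    are kept, so that number can be chosen afterwards, large enough for the gradient to be small on
    all discarded coordinates. The restriction to finitely many coordinates is essential, since the
    compact operator [K B] has no positive lower bound on all of l^2. Existence and uniqueness of
    the minimizers are consequences of the same growth inequality. No spectral theorem enters: the
    square root and the splitting both come from explicit iterations built from [1 - Sigma / c]. *)

Section inner_product.
Context (R : realType) (H : hilbertType R).
Implicit Types u v w : H.

Lemma dotpC u v : dotp u v = dotp v u.
Proof. by rewrite hermC expr0 mul1r. Qed.

Lemma dotpDl u v w : dotp (u + v) w = dotp u w + dotp v w.
Proof. exact: linearDl. Qed.

Lemma dotpZl a u v : dotp (a *: u) v = a * dotp u v.
Proof. exact: linearZl_LR. Qed.

Lemma dotpDr u v w : dotp w (u + v) = dotp w u + dotp w v.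
Proof. by rewrite dotpC dotpDl ![dotp _ w]dotpC. Qed.

Lemma dotpZr a u v : dotp v (a *: u) = a * dotp v u.
Proof. by rewrite dotpC dotpZl dotpC. Qed.

Lemma dotpNl u v : dotp (- u) v = - dotp u v.
Proof. by rewrite -scaleN1r dotpZl mulN1r. Qed.

Lemma dotpNr u v : dotp u (- v) = - dotp u v.
Proof. by rewrite dotpC dotpNl dotpC. Qed.

Lemma dotpBl u v w : dotp (u - v) w = dotp u w - dotp v w.
Proof. by rewrite dotpDl dotpNl. Qed.

Lemma dotpBr u v w : dotp w (u - v) = dotp w u - dotp w v.
Proof. by rewrite dotpDr dotpNr. Qed.

Lemma dotp0l v : dotp 0 v = 0.
Proof. by rewrite -(scale0r 0) dotpZl mul0r. Qed.

Lemma dotp0r v : dotp v 0 = 0.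
Proof. by rewrite dotpC dotp0l. Qed.

Lemma normDsq u v : `|u + v| ^+ 2 = `|u| ^+ 2 + 2 * dotp u v + `|v| ^+ 2.
Proof. by rewrite -!dotp_norm dotpDl !dotpDr (dotpC v u); ring. Qed.

Lemma normBsq u v : `|u - v| ^+ 2 = `|u| ^+ 2 - 2 * dotp u v + `|v| ^+ 2.
Proof. by rewrite normDsq normrN dotpNr; ring. Qed.

End inner_product.

(* The discriminant of [t |-> f (u + t v) (u + t v) >= 0]. *)
Lemma discriminant_ineq (R : realType) (a b c : R) : 0 <= c ->
  (forall t, 0 <= a + 2 * t * b + t ^+ 2 * c) -> b ^+ 2 <= a * c.
Proof.
move=> c0 h; have [c_eq0|c_neq0] := eqVneq c 0.
  have [->|b0] := eqVneq b 0; first by rewrite c_eq0 mulr0 expr0n.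
  have := h (- (a + 1) / (2 * b)); rewrite c_eq0 mulr0 addr0.
  rewrite (_ : 2 * _ * b = - (a + 1)); last by field.
  by rewrite opprD addrA subrr add0r oppr_ge0 leNgt ltr01.
have cp : 0 < c by rewrite lt_def c_neq0.
have := h (- b / c).
rewrite (_ : a + _ + _ = a - b ^+ 2 / c); last by field.
by rewrite subr_ge0 ler_pdivrMr.
Qed.

Section bounded_operators.
Context (R : realType).

Lemma ler_opnorm (U V : normedModType R) (f : 'L(U, V)) x :
  `|f x| <= `|f| * `|x|.
Proof.
have [->|x0] := eqVneq x 0; first by rewrite linear0 !normr0 mulr0.
have := @opnorm_ub R U V f (`|x|^-1 *: x).
rewrite normfZV// lexx => /(_ isT); rewrite linearZ/= normrZ.
by rewrite ger0_norm ?invr_ge0// ler_pdivrMl ?normr_gt0// mulrC opnormE.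
Qed.

Section mkL.
Context (U V : normedModType R) (f : U -> V).

Lemma mkL_subproof : linear f -> (exists M, forall x, `|f x| <= M * `|x|) ->
  f \in @bounded_linear R U V.
Proof. by move=> lf bf; apply/mem_set; split. Qed.

Definition mkL lf bf : 'L(U, V) := bounded_linear_Sub (mkL_subproof lf bf).

End mkL.

Lemma mkLE (U V : normedModType R) (f : U -> V) lf bf x :
  mkL (f := f) lf bf x = f x.
Proof. by []. Qed.

Lemma subLE (U V : normedModType R) (f g : 'L(U, V)) x :
  (f - g) x = f x - g x.
Proof. by []. Qed.

Lemma scaleLE (U V : normedModType R) a (f : 'L(U, V)) x :
  (a *: f) x = a *: f x.
Proof. by []. Qed.

Section morphism.
Context (U V : normedModType R) (f : 'L(U, V)).

Lemma mapLP a u v : f (a *: u + v) = a *: f u + f v.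
Proof. exact: linearP. Qed.

Lemma mapLD u v : f (u + v) = f u + f v.
Proof. exact: linearD. Qed.

Lemma mapLB u v : f (u - v) = f u - f v.
Proof. exact: linearB. Qed.

Lemma mapLN u : f (- u) = - f u.
Proof. exact: linearN. Qed.

Lemma mapLZ a u : f (a *: u) = a *: f u.
Proof. exact: linearZ. Qed.

Lemma mapL0 : f 0 = 0.
Proof. exact: linear0. Qed.

End morphism.

Section compL.
Context (U V W : normedModType R) (g : 'L(V, W)) (f : 'L(U, V)).

Lemma compL_linear : linear (g \o f).
Proof. by move=> a u v /=; rewrite !linearP. Qed.

Lemma compL_bounded : exists M, forall x, `|(g \o f) x| <= M * `|x|.
Proof.
exists (`|g| * `|f|) => x /=; rewrite (le_trans (ler_opnorm _ _))// -mulrA.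
by rewrite ler_wpM2l// ler_opnorm.
Qed.

Definition compL : 'L(U, W) := mkL compL_linear compL_bounded.

Lemma compLE x : compL x = g (f x).
Proof. by []. Qed.

End compL.

Lemma idL_bounded (U : normedModType R) :
  exists M, forall x : U, `|idfun x| <= M * `|x|.
Proof. by exists 1 => x; rewrite mul1r. Qed.

Definition idL (U : normedModType R) : 'L(U, U) :=
  mkL (f := idfun) (fun a u v => erefl) (idL_bounded U).

Lemma idLE (U : normedModType R) x : idL U x = x.
Proof. by []. Qed.

End bounded_operators.

Section cauchy_schwarz.
Context (R : realType) (H : hilbertType R).

Lemma psd_cauchy_schwarz (F : 'L(H, H)) (u v : H) :
  (forall a b, dotp (F a) b = dotp a (F b)) -> (forall a, 0 <= dotp (F a) a) ->
  dotp (F u) v ^+ 2 <= dotp (F u) u * dotp (F v) v.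
Proof.
move=> symF psdF; apply: discriminant_ineq => // t.
have := psdF (u + t *: v); rewrite mapLD mapLZ.
rewrite dotpDl !dotpDr !dotpZl !dotpZr (dotpC (F v) u) -symF.
by congr (0 <= _); ring.
Qed.

Lemma dotp_cauchy_schwarz (u v : H) : `|dotp u v| <= `|u| * `|v|.
Proof.
rewrite -ler_sqr ?nnegrE ?mulr_ge0// exprMn -!dotp_norm -normrX ger0_norm ?sqr_ge0//.
have := @psd_cauchy_schwarz (idL H) u v; rewrite !idLE; apply => // a.
by rewrite idLE dotp_norm sqr_ge0.
Qed.

Lemma dotp_le (u v : H) : dotp u v <= `|u| * `|v|.
Proof. exact: le_trans (ler_norm _) (dotp_cauchy_schwarz u v). Qed.

(** Cauchy-Schwarz for the form [<F a, b>] at [x] and [F x] gives [|F x|^4 <= <F x, x> <F (F x), F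
    x> <= |x|^2 |F x|^2]. *)
Lemma norm_sym_contraction (F : 'L(H, H)) :
  (forall a b, dotp (F a) b = dotp a (F b)) -> (forall a, 0 <= dotp (F a) a) ->
  (forall a, dotp (F a) a <= `|a| ^+ 2) -> forall x, `|F x| <= `|x|.
Proof.
move=> symF psdF F1 x.
have [->|Fx0] := eqVneq (F x) 0; first by rewrite normr0.
have := psd_cauchy_schwarz x (F x) symF psdF.
rewrite dotp_norm => h.
have {}h : (`|F x| ^+ 2) ^+ 2 <= `|x| ^+ 2 * `|F x| ^+ 2.
  by rewrite (le_trans h)// ler_pM.
rewrite -ler_sqr ?nnegrE// -(@ler_pM2r _ (`|F x| ^+ 2))//.
by rewrite exprn_gt0// normr_gt0.
Qed.

End cauchy_schwarz.

(** * Square roots of positive operators *)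

Lemma cauchy_limit (R : realType) (V : completeNormedModType R) (x : nat -> V) :
  (forall e : R, 0 < e -> exists N, forall m n, (N <= n)%N -> (n <= m)%N ->
     `|x m - x n| <= e) ->
  exists l, forall e : R, 0 < e -> exists N, forall n, (N <= n)%N ->
     `|x n - l| <= e.
Proof.
move=> cx; have /cauchy_cvg cvx : cauchy (x @ \oo).
  apply: cauchy_exP => e e0; have [N xN] := cx (e / 2) (divr_gt0 e0 (ltr0Sn _ 1)).
  exists (x N); exists N => // n /= Nn; rewrite -ball_normE /ball_/= distrC.
  by rewrite (le_lt_trans (xN _ _ (leqnn _) Nn))// ltr_pdivrMr// ltr_pMr// ltr1n.
exists (lim (x @ \oo)) => e e0.
have /cvgrPdist_le /(_ e e0)[N _ xN] : x @ \oo --> lim (x @ \oo) by [].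
by exists N => n Nn; rewrite distrC; exact: xN.
Qed.

(** [2 / (n + 2)] is the convergence rate of the square root iteration below. Each identity for its
    limit is proved by bounding the norm of the defect by a multiple of this rate for every [n]. *)
Lemma le0_rate (R : realType) (z C : R) :
  (forall n : nat, z <= C * (2 / n.+2%:R)) -> z <= 0.
Proof.
move=> zC; rewrite leNgt; apply/negP => z0.
have C0 : 0 < C.
  by have := zC 0%N; rewrite divff// mulr1; exact: lt_le_trans.
pose m := Num.truncn (2 * C / z).
have := zC m; rewrite leNgt => /negP; apply.
have := truncnS_gt (2 * C / z); rewrite ltr_pdivrMr// -/m => h.
rewrite mulrA ltr_pdivrMr ?ltr0n// mulrC (lt_le_trans h)// mulrC.
by rewrite ler_pM2l// ler_nat.
Qed.

Lemma exists_rate_lt (R : realType) (e C : R) : 0 < e -> 0 <= C ->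
  exists n : nat, C * (2 / n.+2%:R) <= e.
Proof.
move=> e0 C0; apply: contrapT => /forallNP h.
have := @le0_rate R e C; rewrite leNgt e0 => /(_ _)/negP; apply => //.
by move=> n; have /negP := h n; rewrite -ltNge => /ltW.
Qed.

Section sqrt_contraction.
Context (R : realType) (H : hilbertType R) (F : 'L(H, H)).
Hypotheses (symF : forall a b, dotp (F a) b = dotp a (F b))
  (psdF : forall a, 0 <= dotp (F a) a)
  (F1 : forall a, dotp (F a) a <= `|a| ^+ 2).

(** As [F = 1 - G], the operator [1 - Y] squares to [F] exactly when [2 Y = G + Y^2], an equation
    solved by iteration. *)
Let G : 'L(H, H) := idL H - F.

Let Gcontr x : `|G x| <= `|x|.
Proof.
apply: norm_sym_contraction => {x} [a b|a|a]; rewrite subLE idLE.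
- by rewrite dotpBl dotpBr symF.
- by rewrite dotpBl dotp_norm subr_ge0.
- by rewrite dotpBl dotp_norm gerBl.
Qed.

(* The fixed point iteration for [1 - sqrt F], together with the scalar
   iteration (for [F = 0]) that dominates it. *)
Let Fixpoint Yn n : 'L(H, H) :=
  if n is n'.+1 then 2^-1 *: (G + compL (Yn n') (Yn n')) else 0.

Let Fixpoint an n : R := if n is n'.+1 then 2^-1 * (1 + an n' ^+ 2) else 0.

Let YnS n x : Yn n.+1 x = 2^-1 *: (G x + Yn n (Yn n x)).
Proof. by []. Qed.

Let anS n : an n.+1 = 2^-1 * (1 + an n ^+ 2).
Proof. by []. Qed.

Let an_ge0 n : 0 <= an n.
Proof. by elim: n => //= n IH; rewrite mulr_ge0// addr_ge0// sqr_ge0. Qed.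

Let an_le1 n : an n <= 1.
Proof.
elim: n => //= n IH; rewrite ler_pdivrMl// mulr1 -[2]/(1 + 1) lerD2l.
by rewrite expr_le1.
Qed.

(** The gap [b = 1 - an n] obeys [b' = b - b^2 / 2], so [1 / b] grows by at least [1/2] at each
    step, starting from 1. The induction uses that [x - x^2 / 2] is increasing on [[0, 1]]. *)
Let an_rate n : 1 - an n <= 2 / n.+2%:R.
Proof.
elim: n => [|n IH]; first by rewrite subr0 divff.
rewrite /= (_ : 1 - _ = (1 - an n) - (1 - an n) ^+ 2 / 2); last by field.
set b := 1 - an n in IH *; set t := 2 / n.+2%:R in IH *.
have b1 : b <= 1 by rewrite /b gerBl.
have t1 : t <= 1 by rewrite /t ler_pdivrMr// mul1r ler_nat.
have : b - b ^+ 2 / 2 <= t - t ^+ 2 / 2.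
  rewrite -subr_ge0 (_ : _ - _ = (t - b) * (1 - (t + b) / 2)); last by field.
  rewrite mulr_ge0 ?subr_ge0// ler_pdivrMr// mul1r -[2]/(1 + 1).
  exact: lerD.
move=> /le_trans; apply; rewrite /t.
have n0 : (0 : R) <= n%:R by [].
rewrite -[n.+2]/(2 + n)%N -[n.+3]/(3 + n)%N !natrD.
have h2 : (0 : R) < 2 + n%:R by rewrite ltr_wpDr.
have h3 : (0 : R) < 3 + n%:R by rewrite ltr_wpDr.
rewrite -subr_ge0 (_ : _ - _ = 2 / ((3 + n%:R) * (2 + n%:R) ^+ 2)); last first.
  by field; rewrite !gt_eqF.
by rewrite divr_ge0// mulr_ge0// ?sqr_ge0// ltW.
Qed.

Let Yn_bound n x : `|Yn n x| <= an n * `|x|.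
Proof.
elim: n x => [|n IH] x; first by rewrite [X in `|X|](_ : _ = 0)// normr0 mul0r.
rewrite YnS anS normrZ ger0_norm// -mulrA ler_wpM2l// mulrDl mul1r.
rewrite (le_trans (ler_normD _ _))// lerD// (le_trans (IH _))//.
by rewrite expr2 -mulrA ler_wpM2l.
Qed.

(** A difference of squares is written [P (P - Q) + (P - Q) Q], which needs no commutation. The
    scalar iteration satisfies the same identity, so its increments dominate those of the
    operators. *)
Let Yn_step n x : `|Yn n.+1 x - Yn n x| <= (an n.+1 - an n) * `|x|.
Proof.
elim: n x => [|n IH] x.
  have -> : Yn 0 x = 0 by [].
  by rewrite !subr0; exact: (Yn_bound 1).
have -> : Yn n.+2 x - Yn n.+1 x = 2^-1 *: (Yn n.+1 (Yn n.+1 x - Yn n x) +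
    (Yn n.+1 (Yn n x) - Yn n (Yn n x))).
  rewrite (YnS n.+1) [X in _ - X = _](YnS n); move: (Yn n.+1) (Yn n) => P Q.
  by rewrite -scalerBr mapLB subrKA opprD addrACA subrr add0r.
have -> : an n.+2 - an n.+1 = 2^-1 * (an n.+1 * (an n.+1 - an n) +
    (an n.+1 - an n) * an n).
  rewrite (anS n.+1) [an n.+1 in X in _ - X](anS n).
  by move: (an n.+1) (an n) => p q; ring.
rewrite normrZ ger0_norm// -mulrA ler_wpM2l//.
rewrite (le_trans (ler_normD _ _))// mulrDl lerD//.
  by rewrite (le_trans (Yn_bound _ _))// -mulrA ler_wpM2l.
have an_mono : 0 <= an n.+1 - an n.
  have -> : an n.+1 - an n = 2^-1 * (1 - an n) ^+ 2.
    by rewrite anS; move: (an n) => p; field.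
  by rewrite mulr_ge0 ?sqr_ge0.
by rewrite (le_trans (IH _))// -mulrA ler_wpM2l.
Qed.

Let Yn_diff n m x : (n <= m)%N -> `|Yn m x - Yn n x| <= 2 / n.+2%:R * `|x|.
Proof.
move=> nm; apply: (@le_trans _ _ ((an m - an n) * `|x|)); last first.
  by rewrite ler_wpM2r// (le_trans _ (an_rate n))// lerB.
rewrite -(subnK nm); elim: (m - n)%N => [|k IH].
  by rewrite add0n !subrr normr0 mul0r.
rewrite addSn -(subrK (Yn (k + n) x) (Yn _ x)) -addrA.
rewrite (le_trans (ler_normD _ _))// (le_trans (lerD (Yn_step _ _) IH))//.
by rewrite -mulrDl subrKA.
Qed.

Let Yx_ex x : exists l, forall n, `|Yn n x - l| <= 2 / n.+2%:R * `|x|.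
Proof.
have [e e0|l lP] := @cauchy_limit R H (Yn ^~ x).
  have [n nP] := exists_rate_lt e0 (normr_ge0 x).
  exists n => p q nq qp; rewrite (le_trans (Yn_diff _ qp))// (le_trans _ nP)//.
  by rewrite mulrC ler_wpM2l// ler_wpM2l// lef_pV2 ?posrE// ler_nat !ltnS.
exists l => n; apply/ler_addgt0Pr => e e0; have [N NP] := lP e e0.
rewrite -(subrK (Yn (maxn N n) x) (Yn n x)) -addrA (le_trans (ler_normD _ _))//.
by rewrite lerD ?NP ?leq_maxl// distrC Yn_diff ?leq_maxr.
Qed.

Lemma sqrt_contraction_ex : exists Q : 'L(H, H),
  [/\ (forall u v, dotp (Q u) v = dotp u (Q v)),
      (forall u, 0 <= dotp (Q u) u)
    & (forall u, Q (Q u) = F u)].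
Proof.
have [Y YP] := choice Yx_ex.
have Yb x : `|Y x| <= `|x|.
  rewrite -subr_le0; apply: (@le0_rate _ _ (2 * `|x|)) => n.
  rewrite lerBlDr -(subrK (Yn n x) (Y x)) (le_trans (ler_normD _ _))//.
  rewrite distrC lerD//.
    by rewrite (le_trans (YP _ _))// mulrC -mulrA ler_peMl ?ler1n// mulr_ge0.
  by rewrite (le_trans (Yn_bound _ _))// ler_piMl.
have Ylin : linear Y.
  move=> a u v; apply/eqP; rewrite -subr_eq0 -normr_le0.
  apply: (@le0_rate _ _ (`|a *: u + v| + (`|a| * `|u| + `|v|))) => n.
  rewrite (_ : Y _ - _ = - (Yn n (a *: u + v) - Y (a *: u + v)) +
     (a *: (Yn n u - Y u) + (Yn n v - Y v))); last first.
    rewrite mapLP scalerBr opprB [X in _ = _ + X]addrACA -opprD.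
    by rewrite addrA subrK.
  rewrite (le_trans (ler_normD _ _))// mulrDl lerD//.
    by rewrite normrN mulrC.
  rewrite (le_trans (ler_normD _ _))// mulrDl lerD//.
    by rewrite normrZ -mulrA ler_wpM2l// mulrC.
  by rewrite mulrC.
have Ybd : exists M, forall x, `|Y x| <= M * `|x|.
  by exists 1 => x; rewrite mul1r.
have Ysym u v : dotp (Y u) v = dotp u (Y v).
  apply/eqP; rewrite -subr_eq0 -normr_le0.
  apply: (@le0_rate _ _ (`|u| * `|v| + `|u| * `|v|)) => n.
  have Ynsym : dotp (Yn n u) v = dotp u (Yn n v).
    elim: n u v => [|n IH] u' v'.
      by rewrite -[X in dotp X _]/(0 : H) -[X in _ = dotp _ X]/(0 : H) dotp0l dotp0r.
    rewrite !YnS dotpZl dotpZr dotpDl dotpDr !IH.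
    by rewrite !subLE !idLE dotpBl dotpBr symF.
  have -> : dotp (Y u) v - dotp u (Y v) =
      - dotp (Yn n u - Y u) v + dotp u (Yn n v - Y v).
    by rewrite dotpBl dotpBr Ynsym; ring.
  rewrite (le_trans (ler_normD _ _))// mulrDl lerD//.
    rewrite normrN (le_trans (dotp_cauchy_schwarz _ _))//.
    by rewrite mulrAC ler_wpM2r// mulrC.
  rewrite (le_trans (dotp_cauchy_schwarz _ _))//.
  by rewrite -mulrA ler_wpM2l// mulrC.
have Ysq u : 2 *: Y u = G u + Y (Y u).
  apply/eqP; rewrite -subr_eq0 -normr_le0.
  apply: (@le0_rate _ _ (2 * `|u| + (`|u| + `|u|))) => n.
  have -> : 2 *: Y u - (G u + Y (Y u)) = - (2 *: (Yn n.+1 u - Y u)) +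
      (Yn n (Yn n u - Y u) + (Yn n (Y u) - Y (Y u))).
    rewrite mapLB subrKA scalerBr opprB -[RHS]addrA.
    congr (_ + _); rewrite YnS scalerA divff// scale1r.
    by move: (G u) (Yn n _) (Y (Y u)) => g p q; rewrite !opprD -addrA addKr.
  have e2 : 2 / n.+3%:R <= 2 / n.+2%:R :> R.
    by rewrite ler_wpM2l// lef_pV2 ?posrE// ler_nat.
  rewrite (le_trans (ler_normD _ _))// mulrDl lerD//.
    rewrite normrN normrZ ger0_norm// -mulrA ler_wpM2l//.
    by rewrite (le_trans (YP _ _))// mulrC ler_wpM2l.
  rewrite (le_trans (ler_normD _ _))// mulrDl lerD//.
    rewrite (le_trans (Yn_bound _ _))// mulrC.
    rewrite (le_trans (ler_piMr _ (an_le1 n)))// (le_trans (YP _ _))//.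
    by rewrite mulrC.
  by rewrite (le_trans (YP _ _))// mulrC ler_wpM2r// divr_ge0.
(* Positivity of [1 - Y] comes from [|Y u| <= |u|], and its square is [F] by [Ysq]. *)
pose Q := idL H - mkL Ylin Ybd.
exists Q; split=> [u v|u|u]; rewrite ?subLE ?idLE ?mkLE.
- by rewrite dotpBl dotpBr Ysym.
- rewrite dotpBl dotp_norm subr_ge0 (le_trans (dotp_le _ _))//.
  by rewrite expr2 ler_wpM2r.
  have -> : Y (u - Y u) = Y u - Y (Y u).
    exact: (mapLB (mkL Ylin Ybd)).
  have YY : Y (Y u) = 2 *: Y u - G u by rewrite Ysq addrC addKr.
  rewrite YY scaler_nat mulr2n subLE idLE; move: (Y u) (F u) => y f.
  apply/eqP; rewrite subr_eq eq_sym opprB addrCA (addrA f) (addrC f (u - f)).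
  by rewrite subrK addrCA opprD (addrA y) subrr add0r.
Qed.
End sqrt_contraction.

(** This excludes the default value of [xget]. Dividing [S] by [c = |S| + 1], which is nonzero even
    for [S = 0], gives a form bounded by the identity; its root is then rescaled by the square root
    of [c]. *)
Lemma sqrt_op_spec (R : realType) (H : hilbertType R) (S : 'L(H, H)) :
  (forall a b, dotp (S a) b = dotp a (S b)) -> (forall a, 0 <= dotp (S a) a) ->
  [/\ (forall u v, dotp (sqrt_op S u) v = dotp u (sqrt_op S v)),
      (forall u, 0 <= dotp (sqrt_op S u) u)
    & (forall u, sqrt_op S (sqrt_op S u) = S u)].
Proof.
move=> symS psdS; rewrite /sqrt_op; case: xgetP => [_ -> //|none].
pose c := `|S| + 1; have c0 : 0 < c by rewrite ltr_wpDl.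
pose F := c^-1 *: S.
have [Q [symQ psdQ QQ]] : exists Q : 'L(H, H),
  [/\ (forall u v, dotp (Q u) v = dotp u (Q v)),
      (forall u, 0 <= dotp (Q u) u)
    & (forall u, Q (Q u) = F u)].
  apply: sqrt_contraction_ex => [a b|a|a]; rewrite scaleLE.
  - by rewrite dotpZl dotpZr symS.
  - by rewrite dotpZl mulr_ge0// invr_ge0 ltW.
  - rewrite dotpZl ler_pdivrMl// (le_trans (dotp_le _ _))// expr2 mulrA.
    rewrite ler_wpM2r// (le_trans (ler_opnorm _ _))// ler_wpM2r//.
    by rewrite /c lerDl.
exfalso; apply: (none (Num.sqrt c *: Q)); split=> [u v|u|u]; rewrite !scaleLE.
- by rewrite dotpZl dotpZr symQ.
- by rewrite dotpZl mulr_ge0.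
- rewrite mapLZ QQ scalerA -expr2 sqr_sqrtr ?ltW// scaleLE scalerA divff ?scale1r//.
  by rewrite gt_eqF.
Qed.

(** * Compact operators *)

Lemma nonincreasing_cauchy (R : realType) (c : nat -> R) :
  (forall n, 0 <= c n) -> (forall n m, (n <= m)%N -> c m <= c n) ->
  forall e, 0 < e -> exists N, forall n, (N <= n)%N -> c N - c n <= e.
Proof.
move=> c0 cmono e e0.
have hi : has_inf (range c).
  by split; [exists (c 0%N), 0%N|exists 0 => _ [n _ <-]].
have [_ [N _ <-] cN] := inf_adherent e0 hi.
exists N => n Nn; rewrite lerBlDr addrC.
by rewrite (le_trans (ltW cN))// lerD2r ge_inf//; case: hi.
Qed.

Section power_iteration.
Context (R : realType) (H : hilbertType R) (S : 'L(H, H)).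
Hypotheses (symS : forall a b, dotp (S a) b = dotp a (S b))
  (psdS : forall a, 0 <= dotp (S a) a).

Let c := `|S| + 1.
Let c0 : 0 < c. Proof. by rewrite ltr_wpDl. Qed.

(* Locked so that linearity lemmas do not unfold the sum. *)
Definition relax : 'L(H, H) := locked (idL H - (`|S| + 1)^-1 *: S).

Lemma relaxE x : relax x = x - c^-1 *: S x.
Proof. by rewrite /relax -lock. Qed.

Lemma relax_sym a b : dotp (relax a) b = dotp a (relax b).
Proof. by rewrite !relaxE dotpBl dotpBr dotpZl dotpZr symS. Qed.

Lemma relax_psd a : 0 <= dotp (relax a) a.
Proof.
rewrite relaxE dotpBl dotpZl subr_ge0 dotp_norm.
rewrite ler_pdivrMl// (le_trans (dotp_le _ _))// expr2 mulrA.
by rewrite ler_wpM2r// (le_trans (ler_opnorm _ _))// ler_wpM2r// /c lerDl.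
Qed.

Lemma relax_contraction x : `|relax x| <= `|x|.
Proof.
apply: norm_sym_contraction => {x} [a b|a|a].
- exact: relax_sym.
- exact: relax_psd.
- by rewrite relaxE dotpBl dotp_norm dotpZl gerBl mulr_ge0// invr_ge0 ltW.
Qed.

Lemma iter_relaxD n x y :
  iter n relax (x + y) = iter n relax x + iter n relax y.
Proof. by elim: n => // n IH; rewrite !iterS IH mapLD. Qed.

Lemma iter_relaxZ n a x : iter n relax (a *: x) = a *: iter n relax x.
Proof. by elim: n => // n IH; rewrite !iterS IH mapLZ. Qed.

Lemma iter_relax_sym n a b :
  dotp (iter n relax a) b = dotp a (iter n relax b).
Proof. by elim: n a b => // n IH a b; rewrite [RHS]/= -relax_sym -IH -iterSr. Qed.

Lemma iter_relax_le m n x : (m <= n)%N ->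
  `|iter n relax x| <= `|iter m relax x|.
Proof.
move=> mn; rewrite -(subnK mn) iterD; move: (iter m _ _) => y.
elim: (n - m)%N => //= k; exact/le_trans/relax_contraction.
Qed.

Lemma iter_relax_contraction n x : `|iter n relax x| <= `|x|.
Proof. exact: (iter_relax_le x (leq0n n)). Qed.

(** Telescoping: step [k] contributes [S (c^-1 relax^k x)], so [w] is a sum of [n] terms, each of
    norm at most [|x|] because [c >= 1] and [relax] is a contraction. *)
Lemma iter_relax_residual n x :
  exists w, x - iter n relax x = S w /\ `|w| <= n%:R * `|x|.
Proof.
elim: n => [|n [w [xw wb]]]; first by exists 0; rewrite subrr mapL0 normr0 mul0r.
exists (w + c^-1 *: iter n relax x); split.
  rewrite mapLD mapLZ -xw iterS relaxE; move: (iter n _ _) => y.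
  by rewrite opprD opprK addrA.
rewrite (le_trans (ler_normD _ _))// -natr1 mulrDl mul1r lerD//.
rewrite normrZ gtr0_norm ?invr_gt0//.
rewrite (le_trans _ (iter_relax_contraction n x))// ler_piMl// invf_le1//.
by rewrite /c lerDr.
Qed.

(** With [b n = |relax^n z|^2], symmetry turns the scalar product of the iterates of orders [2 m]
    and [2 n] into [b (n + m)]; only even orders allow this. Their squared distance is then at most
    [b (2 n) - b (2 m)] for [n <= m], so they form a Cauchy sequence since [b] decreases. The limit
    is a fixed point of [relax], hence in the kernel of [S]. *)
Lemma iter_relax_cvg0 : injective S -> forall z e, 0 < e ->
  exists N, forall n, (N <= n)%N -> `|iter n relax z| <= e.
Proof.
move=> injS z e e0; pose x n := iter (n + n) relax z.
have cauchy_x d : 0 < d -> exists N, forall m n, (N <= n)%N -> (n <= m)%N ->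
    `|x m - x n| <= d.
  move=> d0; have d20 : 0 < d ^+ 2 by rewrite exprn_gt0.
  pose b n := `|iter n relax z| ^+ 2.
  have b_mono n m : (n <= m)%N -> b m <= b n.
    by move=> nm; rewrite /b ler_sqr ?nnegrE// iter_relax_le.
  have [N NP] := nonincreasing_cauchy (c := b) (fun n => sqr_ge0 _) b_mono d20.
  exists N => m n Nn nm; rewrite -ler_sqr ?nnegrE ?(ltW d0)// normBsq.
  have -> : dotp (x m) (x n) = b (n + m)%N.
    rewrite /b -dotp_norm /x [in LHS]iterD iter_relax_sym -iterD.
    by rewrite addnA (addnC m n) -addnA iterD -iter_relax_sym -iterD addnC.
  have bm : b (m + m)%N <= b (n + m)%N by rewrite b_mono// leq_add2r.
  have bn : b (n + n)%N <= b N by rewrite b_mono// (leq_trans Nn)// leq_addr.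
  have bN : b N - b (m + m)%N <= d ^+ 2.
    by apply: NP; rewrite (leq_trans Nn)// (leq_trans nm)// leq_addr.
  by rewrite -/(b (m + m)%N) -/(b (n + n)%N); lra.
have [w wP] := cauchy_limit cauchy_x.
have RRw : relax (relax w) = w.
  apply/eqP; rewrite -subr_eq0 -normr_le0; apply/ler_addgt0Pr => d d0.
  have d20 : 0 < d / 2 by rewrite divr_gt0.
  have [N NP] := wP _ d20; rewrite add0r.
  have -> : relax (relax w) - w = - relax (relax (x N - w)) + (x N.+1 - w).
    have -> : x N.+1 = relax (relax (x N)) by rewrite /x addSn addnS !iterS.
    move: (x N) => t; rewrite !mapLB opprB.
    by rewrite subrKA.
  rewrite (le_trans (ler_normD _ _))// normrN [leRHS](splitr d) lerD ?NP//.
  by rewrite 2?(le_trans (relax_contraction _))// NP.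
(* [v = w - relax w] satisfies [relax v = - v], which positivity of [relax] permits only for
   [v = 0]. *)
have w_fix : relax w = w.
  apply/eqP; rewrite eq_sym -subr_eq0 -normr_le0; set v := w - relax w.
  have : 0 <= dotp (relax v) v by exact: relax_psd.
  rewrite /v mapLB RRw -opprB -/v dotpNl dotp_norm oppr_ge0 => h.
  by rewrite -(@ler_sqr _ `|v| 0) ?nnegrE// expr0n.
have w0 : w = 0.
  apply: injS; rewrite mapL0; move/eqP: w_fix.
  rewrite relaxE -subr_eq0 addrAC subrr add0r oppr_eq0 scaler_eq0 invr_eq0.
  by rewrite gt_eqF// => /eqP.
have [N NP] := wP e e0; exists (N + N)%N => n Nn.
rewrite (le_trans (iter_relax_le _ Nn))//.
by have := NP N (leqnn _); rewrite w0 subr0.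
Qed.

End power_iteration.

Lemma compact_net (R : realType) (V : normedModType R) (A : set V) (e : R) :
  compact A -> 0 < e ->
  exists s : seq V, (forall z, z \in s -> A z) /\
    forall x, A x -> exists2 z, z \in s & `|x - z| < e.
Proof.
rewrite compact_cover => cA e0.
have cov0 : A `<=` cover A (fun x => ball x e).
  by move=> x Ax; exists x => //; exact: ballxx.
have [D' D'A cov] := cA V A (fun x => ball x e) (fun x _ => ball_open x e) cov0.
exists D'; split=> [z /D'A|x /cov[z /= zD']]; first by rewrite inE.
by rewrite -ball_normE /ball_/= => xz; exists z => //; rewrite distrC.
Qed.

Section compact_operators.
Context (R : realType) (U V : normedModType R) (K : U -> V).
Hypothesis cK : compact_operator K.

Lemma compact_operator_net (e : R) : 0 < e ->
  exists s : seq V, forall x, `|x| <= 1 -> exists2 z, z \in s & `|K x - z| < e.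
Proof.
move=> e0; pose D := [set x : U | `|x| <= 1].
have bD : bounded_set D.
  exists 1; split; first exact: num_real.
  by move=> M M1 x /= Dx; rewrite (le_trans Dx)// ltW.
have := cK.2 D bD; rewrite precompactE => cKD.
have [s [_ sP]] := compact_net cKD e0.
by exists s => x Dx; apply: sP; apply: subset_closure; exists x.
Qed.

Lemma compact_operator_bounded : exists M, forall x, `|K x| <= M * `|x|.
Proof.
have [s sP] := compact_operator_net ltr01.
pose M := \sum_(z <- s) `|z|.
have KM x : `|x| <= 1 -> `|K x| <= M + 1.
  move=> x1; have [z zs xz] := sP x x1.
  rewrite -(subrK z (K x)) addrC (le_trans (ler_normD _ _))// lerD//; last exact: ltW.
  rewrite /M (perm_big _ (perm_to_rem zs)) big_cons lerDl.
  by rewrite sumr_ge0.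
have K0 : K 0 = 0.
  by have := cK.1 (-1) 0 0; rewrite scaler0 addr0 scaleN1r addNr.
exists (M + 1) => x; have [->|x0] := eqVneq x 0.
  by rewrite K0 !normr0 mulr0.
have KZ a y : K (a *: y) = a *: K y.
  by have := cK.1 a y 0; rewrite K0 !addr0.
have := KM (`|x|^-1 *: x); rewrite normfZV// lexx => /(_ isT).
by rewrite KZ normrZ ger0_norm ?invr_ge0// ler_pdivrMl ?normr_gt0// mulrC.
Qed.

Definition compactL : 'L(U, V) := mkL cK.1 compact_operator_bounded.

Lemma compactLE x : compactL x = K x.
Proof. by []. Qed.

End compact_operators.

(** Pointwise convergence is uniform on a finite net of the image of the unit ball, and the
    iterates, being contractions, carry it from the net to the whole image. Homogeneity then gives
    the factor [|x|]. *)
Lemma iter_relax_compact (R : realType) (U : normedModType R)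
    (H : hilbertType R) (S : 'L(H, H)) (K : U -> H) :
  (forall a b, dotp (S a) b = dotp a (S b)) -> (forall a, 0 <= dotp (S a) a) ->
  injective S -> compact_operator K -> forall e, 0 < e ->
  exists n, forall x, `|iter n (relax S) (K x)| <= e * `|x|.
Proof.
move=> symS psdS injS cK e e0; have e20 : 0 < e / 2 by rewrite divr_gt0.
have [s sP] := compact_operator_net cK e20.
have [N NP] : exists N, forall z, z \in s -> `|iter N (relax S) z| <= e / 2.
  elim: s {sP} => [|z s [N NP]]; first by exists 0%N.
  have [M MP] := iter_relax_cvg0 symS psdS injS z e20.
  exists (maxn N M) => t; rewrite inE => /orP[/eqP ->|ts].
    by rewrite MP// leq_maxr.
  by rewrite (le_trans _ (NP t ts))// iter_relax_le// leq_maxl.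
have h x : `|x| <= 1 -> `|iter N (relax S) (K x)| <= e.
  move=> /sP[z zs xz]; rewrite -(subrK z (K x)) iter_relaxD.
  rewrite (le_trans (ler_normD _ _))// [leRHS](splitr e) lerD ?(NP z)//.
  by rewrite (le_trans (iter_relax_contraction symS psdS _ _))// ltW.
exists N => x; have [->|x0] := eqVneq x 0.
  rewrite -(compactLE cK) mapL0 normr0 mulr0.
  by rewrite (le_trans (iter_relax_contraction symS psdS _ _))// normr0.
have := h (`|x|^-1 *: x); rewrite normfZV// lexx => /(_ isT).
rewrite -(compactLE cK) mapLZ iter_relaxZ normrZ ger0_norm ?invr_ge0//.
by rewrite ler_pdivrMl ?normr_gt0// mulrC.
Qed.

(** * Truncation in l^2 *)

Section l2_space.
Context (R : realType).
Implicit Types (u v : l2 R).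

Lemma l2B u v i : (u - v) i = u i - v i.
Proof. by []. Qed.

Lemma l2_sum (I : Type) (s : seq I) (P : pred I) (F : I -> l2 R) i :
  (\sum_(j <- s | P j) F j) i = \sum_(j <- s | P j) F j i.
Proof. by elim/big_rec2: _ => // j x y _ <-. Qed.

Lemma l2P u v : (forall i, u i = v i) -> u = v.
Proof. by move=> uv; apply/LfuneqP. Qed.

Lemma l2_basisE i j : l2_basis R i j = (j == i)%:R.
Proof. by []. Qed.

Lemma l2_normsq u : (`|u| ^+ 2)%:E = (\sum_(k <oo) (u k ^+ 2)%:E)%E.
Proof.
have -> : `|u| ^+ 2 = `|u| `^ 2 by rewrite powR_mulrn.
have e1 : (`|u|)%:E = 'N[counting]_2%:E[EFin \o u]%E by exact: finite_norm_fine.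
rewrite -poweR_EFin e1 poweR_Lnorm// ge0_integral_count//; last first.
  by move=> k; exact: poweR_ge0.
apply: eq_eseriesr => k _.
rewrite [LHS](_ : _ = ((`|u k|)%:E `^ 2)%E)// poweR_EFin.
by rewrite powR_mulrn// real_normK ?num_real.
Qed.

Lemma l2_normsq_split n u : (`|u| ^+ 2)%:E =
  ((\sum_(i < n) u i ^+ 2)%:E + \sum_(n <= k <oo) (u k ^+ 2)%:E)%E.
Proof.
rewrite l2_normsq (nneseries_split 0%N n); last first.
  by move=> k _; rewrite lee_fin sqr_ge0.
by rewrite add0n big_mkord sumEFin.
Qed.

Lemma l1norm_series u : l1norm u = (\sum_(k <oo) (`|u k|)%:E)%E.
Proof. by rewrite /l1norm Lnorm1 ge0_integral_count. Qed.

Definition l1tail n u : \bar R := (\sum_(n <= k <oo) (`|u k|)%:E)%E.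

Lemma l1tail_ge0 n u : (0 <= l1tail n u)%E.
Proof. exact: nneseries_ge0. Qed.

Lemma l1norm_split n u :
  l1norm u = ((\sum_(i < n) `|u i|)%:E + l1tail n u)%E.
Proof.
rewrite l1norm_series (nneseries_split 0%N n)// add0n; congr (_ + _)%E.
by rewrite big_mkord sumEFin.
Qed.

Lemma l2_basis_norm i : `|l2_basis R i| = 1.
Proof.
apply/eqP; rewrite -(@eqrXn2 _ 2)// expr1n -eqe; apply/eqP.
rewrite l2_normsq (@nneseriesD1 _ _ i)//; last by move=> k _; rewrite lee_fin sqr_ge0.
rewrite l2_basisE eqxx expr1n eseries0 ?adde0// => k _ /andP[_ /negbTE ki].
by rewrite l2_basisE ki expr0n.
Qed.

Lemma l2_sum_basisE n (a : 'I_n -> R) j :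
  (\sum_(i < n) a i *: l2_basis R i) j = oapp a 0 (insub j).
Proof.
have -> : (\sum_(i < n) a i *: l2_basis R i) j = \sum_(i < n) a i * (j == i :> nat)%:R.
  by rewrite l2_sum.
case: insubP => [i _ <-|jn].
  rewrite (bigD1 i)//= big1 ?addr0 ?eqxx ?mulr1// => k ki.
  by rewrite val_eqE eq_sym (negbTE ki) mulr0.
rewrite big1// => i _.
by case: eqP => [ji|_]; [rewrite ji ltn_ord in jn|rewrite mulr0].
Qed.

Lemma l2_sum_basis_normsq n (a : 'I_n -> R) :
  `|\sum_(i < n) a i *: l2_basis R i| ^+ 2 = \sum_(i < n) a i ^+ 2.
Proof.
apply: EFin_inj; rewrite (l2_normsq_split n) eseries0 ?adde0.
  by congr EFin; apply: eq_bigr => i _; rewrite l2_sum_basisE valK.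
move=> k nk _; rewrite l2_sum_basisE insubF ?expr0n//.
by apply/negbTE; rewrite -leqNgt.
Qed.

Definition l2_trunc n u : l2 R := \sum_(0 <= i < n) u i *: l2_basis R i.

Lemma l2_truncE n u j : l2_trunc n u j = if (j < n)%N then u j else 0.
Proof.
rewrite /l2_trunc big_mkord (l2_sum_basisE (fun i : 'I_n => u i)).
by case: insubP => [i -> <-|/negbTE ->].
Qed.

Lemma l2_trunc_normsq n u :
  (`|u - l2_trunc n u| ^+ 2)%:E = (\sum_(n <= k <oo) (u k ^+ 2)%:E)%E.
Proof.
rewrite (l2_normsq_split n) big1 ?add0e => [|i _]; last first.
  by rewrite l2B l2_truncE ltn_ord subrr expr0n.
rewrite eseries_cond [RHS]eseries_cond.
apply: eq_eseriesr => k; rewrite andTb => nk.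
by rewrite l2B l2_truncE ltnNge nk subr0.
Qed.

Lemma l2_trunc_cvg u e : 0 < e ->
  exists N, forall n, (N <= n)%N -> `|u - l2_trunc n u| <= e.
Proof.
move=> e0.
have fin : (\sum_(0 <= k <oo | true) (u k ^+ 2)%:E < +oo)%E.
  by rewrite -[X in (X < _)%E](l2_normsq u) ltry.
have sq0 k : true -> (0 <= (u k ^+ 2)%:E)%E by rewrite lee_fin sqr_ge0.
have /fine_cvg := nneseries_tail_cvg fin sq0.
have e20 : 0 < e ^+ 2 by rewrite exprn_gt0.
move=> /cvgrPdist_le/(_ _ e20)[N _ NP]; exists N => n Nn.
rewrite -ler_sqr ?nnegrE ?(ltW e0)//; have := NP n Nn.
by rewrite /= -l2_trunc_normsq/= sub0r normrN ger0_norm// sqr_ge0.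
Qed.

(* A bounded operator is controlled on [l^1] by its values on the basis. *)
Lemma l1tail_bound (V : normedModType R) (f : 'L(l2 R, V)) n u M t :
  (forall i, (n <= i)%N -> `|f (l2_basis R i)| <= M) -> l1tail n u = t%:E ->
  `|f (u - l2_trunc n u)| <= M * t.
Proof.
move=> fM ut; apply/ler_addgt0Pr => e e0.
have M0 : 0 <= M by rewrite (le_trans _ (fM n (leqnn n))).
have d0 : 0 < e / (`|f| + 1) by rewrite divr_gt0// ltr_wpDl.
have [N NP] := l2_trunc_cvg u d0; pose m := maxn N n.
(* The tail is cut again at [m]: the far part is small in l^2 and is controlled by [|f|] alone, the
   part between [n] and [m] is a finite sum bounded by [M * t]. *)
have -> : f (u - l2_trunc n u) =
    f (u - l2_trunc m u) + \sum_(n <= i < m) u i *: f (l2_basis R i).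
  rewrite !mapLB -addrA; congr (_ + _).
  rewrite [l2_trunc m u](@big_cat_nat _ _ _ n) ?leq_maxr// mapLD opprD -addrA.
  suff -> : f (\sum_(n <= i < m) u i *: l2_basis R i) =
      \sum_(n <= i < m) u i *: f (l2_basis R i) by rewrite addNr addr0.
  by rewrite raddf_sum; apply: eq_bigr => i _; exact: mapLZ.
rewrite addrC (le_trans (ler_normD _ _))// lerD//; last first.
  rewrite (le_trans (ler_opnorm _ _))//.
  have := NP m (leq_maxl _ _); rewrite ler_pdivlMr ?ltr_wpDl// mulrC.
  by apply: le_trans; rewrite ler_wpM2r// lerDl.
rewrite (le_trans (ler_norm_sum _ _ _))//.
apply: (@le_trans _ _ (\sum_(n <= i < m) M * `|u i|)).
  rewrite big_seq_cond [leRHS]big_seq_cond; apply: ler_sum => i.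
  rewrite mem_index_iota andbT => /andP[ni _].
  by rewrite normrZ mulrC ler_wpM2r// fM.
rewrite -mulr_sumr ler_wpM2l// -lee_fin -ut -sumEFin.
exact: (@nneseries_lim_ge _ (fun k => (`|u k|)%:E) xpredT n m).
Qed.

Section embedding.
Context (n : nat).
Implicit Types (p q : 'rV[R]_n).

Definition l2_embed p : l2 R := \sum_(i < n) p 0 i *: l2_basis R i.

Definition rV_l1 p : R := \sum_(i < n) `|p 0 i|.

Definition l2_head u : 'rV[R]_n := \row_i u i.

Lemma l2_embedE p j : l2_embed p j = oapp (fun i => p 0 i) 0 (insub j).
Proof. exact: (l2_sum_basisE (fun i => p 0 i)). Qed.

Lemma l2_embedP a p q : l2_embed (a *: p + q) = a *: l2_embed p + l2_embed q.
Proof.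
rewrite /l2_embed scaler_sumr -big_split; apply: eq_bigr => i _ /=.
by rewrite !mxE scalerDl scalerA.
Qed.

Lemma l2_embed0 : l2_embed 0 = 0.
Proof. by rewrite /l2_embed big1// => i _; rewrite mxE scale0r. Qed.

Lemma l2_embedZ a p : l2_embed (a *: p) = a *: l2_embed p.
Proof. by rewrite -[a *: p]addr0 l2_embedP l2_embed0 addr0. Qed.

Lemma l2_embedD p q : l2_embed (p + q) = l2_embed p + l2_embed q.
Proof. by rewrite -[p]scale1r l2_embedP !scale1r. Qed.

Lemma l2_embedB p q : l2_embed (p - q) = l2_embed p - l2_embed q.
Proof. by rewrite l2_embedD -scaleN1r l2_embedZ scaleN1r. Qed.

Lemma l2_embedK p : l2_head (l2_embed p) = p.
Proof. by apply/rowP => i; rewrite mxE l2_embedE valK. Qed.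

Lemma l2_headK u : l2_embed (l2_head u) = l2_trunc n u.
Proof.
apply: l2P => j; rewrite l2_embedE l2_truncE.
by case: insubP => [i -> <-|/negbTE ->] //=; rewrite mxE.
Qed.

Lemma l1norm_head u : l1norm u = ((rV_l1 (l2_head u))%:E + l1tail n u)%E.
Proof.
by rewrite (l1norm_split n); congr (_%:E + _)%E; apply: eq_bigr => i _; rewrite mxE.
Qed.

Lemma l1tail_embed p : l1tail n (l2_embed p) = 0%E.
Proof.
rewrite /l1tail eseries0// => k nk _; rewrite l2_embedE insubF ?normr0//.
by apply/negbTE; rewrite -leqNgt.
Qed.

Lemma l1norm_embed p : l1norm (l2_embed p) = (rV_l1 p)%:E.
Proof. by rewrite l1norm_head l2_embedK l1tail_embed adde0. Qed.

Lemma l1tail0_embed u : l1tail n u = 0%E -> u = l2_embed (l2_head u).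
Proof.
move=> u0; rewrite l2_headK; apply: l2P => j; rewrite l2_truncE.
case: ltnP => // nj; have : ((`|u j|)%:E <= l1tail n u)%E.
  apply: le_trans (nneseries_lim_ge j.+1 _) => //.
  by rewrite big_nat_recr//= leeDr// sume_ge0.
by rewrite u0 lee_fin normr_le0 => /eqP.
Qed.

Lemma l2_embed_span p : l2_span [fset i in iota 0 n]%fset (l2_embed p).
Proof.
exists (l2_embed p); rewrite (perm_big (iota 0 n)).
  rewrite -[X in iota _ X]subn0 -/(index_iota 0 n) big_mkord.
  by apply: eq_bigr => i _; rewrite l2_embedE valK.
by rewrite uniq_perm ?iota_uniq ?fset_uniq// => i; rewrite !inE.
Qed.

Lemma rV_l1_ge0 p : 0 <= rV_l1 p.
Proof. exact: sumr_ge0. Qed.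

Lemma norm_l2_embed p : `|l2_embed p| <= rV_l1 p.
Proof.
rewrite (le_trans (ler_norm_sum _ _ _))// ler_sum// => i _.
by rewrite normrZ l2_basis_norm mulr1.
Qed.

Lemma rV_l1_triangle p q : rV_l1 (p + q) <= rV_l1 p + rV_l1 q.
Proof.
by rewrite /rV_l1 -big_split ler_sum// => i _; rewrite mxE ler_normD.
Qed.

Lemma rV_l1Z a p : rV_l1 (a *: p) = `|a| * rV_l1 p.
Proof.
by rewrite /rV_l1 mulr_sumr; apply: eq_bigr => i _; rewrite mxE normrM.
Qed.

Lemma rV_coord_le_norm p i : `|p 0 i| <= `|p|.
Proof.
by rewrite [leRHS]mx_normrE; exact: (le_bigmax _ (fun i => `|p i.1 i.2|) (0, i)).
Qed.

(** The norm of ['rV[R]_n] is the sup norm. *)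
Lemma rV_l1_le_norm p : rV_l1 p <= n%:R * `|p|.
Proof.
rewrite mulr_natl -[X in _ *+ X](card_ord n) -sumr_const.
by apply: ler_sum => i _; exact: rV_coord_le_norm.
Qed.

Lemma norm_le_rV_l1 p : `|p| <= rV_l1 p.
Proof.
rewrite [leLHS]mx_normrE; apply/bigmax_leP; split; first exact: rV_l1_ge0.
move=> [i j] _ /=; rewrite (ord1 i) /rV_l1 (bigD1 j)//= lerDl.
exact: sumr_ge0.
Qed.

End embedding.
End l2_space.

(** * Minimizers of the l^1-penalized objective *)

(** The bound is asked for only at distance at most 1, with a constant depending on the point, so
    that quadratic functions qualify. *)
Lemma compact_locally_lipschitz_min (R : realType) (V : normedModType R)
    (A : set V) (f : V -> R) : A !=set0 -> compact A ->
  (forall a, A a -> exists L, forall b, A b -> `|a - b| <= 1 ->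
     `|f a - f b| <= L * `|a - b|) ->
  exists2 a, A a & forall b, A b -> f a <= f b.
Proof.
move=> A0 cA fL.
have cf : {within A, continuous f}.
  rewrite continuous_subspace_in => a /set_mem Aa.
  have [L fa] := fL a Aa.
  apply/cvgrPdist_le => e e0; rewrite -nbhs_subspace_in//.
  pose d := Num.min 1 (e / (`|L| + 1)).
  have d0 : 0 < d by rewrite lt_min ltr01 divr_gt0// ltr_wpDl.
  suff : nbhs a [set b | A b -> `|f a - f b| <= e] by [].
  apply: filterS (nbhsx_ballx a d d0) => b.
  rewrite -ball_normE /ball_/= lt_min => /andP[ab1 abe] Ab.
  rewrite (le_trans (fa b Ab (ltW ab1)))//.
  rewrite ltr_pdivlMr ?ltr_wpDl// mulrC in abe; apply: le_trans (ltW abe).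
  by rewrite ler_wpM2r// (le_trans (ler_norm L))// lerDl.
have [a aA amin] := compact_EVT_min A0 cA cf.
exists a; first exact: set_mem.
by move=> b Ab; apply: amin; exact: mem_set.
Qed.

Lemma ge0_first_order (R : realType) (a b : R) :
  (forall t, 0 < t -> t <= 1 -> 0 <= t * a + t ^+ 2 * b) -> 0 <= a.
Proof.
move=> h; rewrite leNgt; apply/negP => a0.
pose c := `|b| - a; have c0 : 0 < c by rewrite subr_gt0 (lt_le_trans a0).
pose t := - a / (2 * c).
have t0 : 0 < t by rewrite divr_gt0// ?oppr_gt0// mulr_gt0.
have t1 : t <= 1.
  rewrite ler_pdivrMr ?mulr_gt0// mul1r /c.
  have := normr_ge0 b; lra.
have := h t t0 t1; rewrite expr2 -mulrA -mulrDr pmulr_rge0// => h1.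
have tb : t * b <= - a / 2.
  have <- : t * c = - a / 2 by rewrite /t; field; rewrite gt_eqF.
  by rewrite ler_wpM2l ?(ltW t0)// /c (le_trans (ler_norm b))// lerBrDl gerDr ltW.
lra.
Qed.

Section lasso.
Context (R : realType) (Y : hilbertType R) (Q : 'L(Y, Y)).
Hypothesis symQ : forall a b, dotp (Q a) b = dotp a (Q b).
Implicit Types (T : 'L(l2 R, Y)) (y : Y) (u h : l2 R).

Definition lasso_smooth T y u : R := 2^-1 * `|Q (T u)| ^+ 2 - dotp y (T u).

Definition lasso T y u : \bar R := ((lasso_smooth T y u)%:E + l1norm u)%E.

Definition lasso_fin n T y (p : 'rV[R]_n) : R :=
  lasso_smooth T y (l2_embed p) + rV_l1 p.

(** The gradient of [lasso_smooth] at [u] is minus the adjoint of [T] applied to this vector.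
    Keeping it in [Y] avoids the adjoint. *)
Definition residual T y u : Y := y - Q (Q (T u)).

Lemma lasso_smooth0 T y : lasso_smooth T y 0 = 0.
Proof. by rewrite /lasso_smooth !mapL0 normr0 expr0n mulr0 dotp0r subr0. Qed.

Lemma lasso_smoothD T y u h : lasso_smooth T y (u + h) =
  lasso_smooth T y u - dotp (residual T y u) (T h) + 2^-1 * `|Q (T h)| ^+ 2.
Proof.
by rewrite /lasso_smooth /residual !mapLD normDsq dotpDr dotpBl [dotp (Q (Q _)) _]symQ; field.
Qed.

Lemma lasso_embed n T y (p : 'rV[R]_n) :
  lasso T y (l2_embed p) = (lasso_fin T y p)%:E.
Proof. by rewrite /lasso l1norm_embed. Qed.

(** First-order optimality: move from [p0] towards [p] by a step [t <= 1], use convexity of the l^1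
    norm on that segment, and let [t] tend to 0. *)
Lemma lasso_fin_variational n T y (p0 : 'rV[R]_n) :
  (forall p : 'rV[R]_n, lasso_fin T y p0 <= lasso_fin T y p) -> forall p,
  0 <= rV_l1 p - rV_l1 p0 -
    dotp (residual T y (l2_embed p0)) (T (l2_embed (p - p0))).
Proof.
move=> p0min p.
apply: (@ge0_first_order _ _ (2^-1 * `|Q (T (l2_embed (p - p0)))| ^+ 2)).
move=> t t0 t1; have := p0min (p0 + t *: (p - p0)).
rewrite -subr_ge0 /lasso_fin l2_embedD lasso_smoothD l2_embedZ !mapLZ.
rewrite normrZ exprMn real_normK ?num_real// dotpZr => /le_trans; apply.
have : rV_l1 (p0 + t *: (p - p0)) <= (1 - t) * rV_l1 p0 + t * rV_l1 p.
  have -> : p0 + t *: (p - p0) = (1 - t) *: p0 + t *: p.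
    by rewrite scalerBr scalerBl scale1r addrAC addrA.
  rewrite (le_trans (rV_l1_triangle _ _))// !rV_l1Z (gtr0_norm t0).
  by rewrite ger0_norm// subr_ge0.
set a := rV_l1 p; set b := rV_l1 p0; set c := rV_l1 _; move=> h.
rewrite -subr_ge0; set X := dotp _ _; set W := `|_| ^+ 2; set Z := lasso_smooth _ _ _.
have -> : t * (a - b - X) + t ^+ 2 * (2^-1 * W) -
  (Z - t * X + 2^-1 * (t ^+ 2 * W) + c - (Z + b)) = (1 - t) * b + t * a - c by ring.
by rewrite subr_ge0.
Qed.

(** The smooth part is exactly quadratic, so its second-order term survives in full. Its first-order
    term is balanced on the first [n] coordinates by the variational inequality; on the others it is
    at most [|residual| M <= 1/2] per unit of l^1 norm, which leaves half of the tail. An infinite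
    tail makes both sides infinite. *)
Lemma lasso_growth n T y (p0 : 'rV[R]_n) M :
  (forall p : 'rV[R]_n, lasso_fin T y p0 <= lasso_fin T y p) ->
  (forall i, (n <= i)%N -> `|T (l2_basis R i)| <= M) ->
  `|residual T y (l2_embed p0)| * M <= 2^-1 -> forall u,
  ((lasso_fin T y p0 + 2^-1 * `|Q (T (u - l2_embed p0))| ^+ 2)%:E +
    (2^-1)%:E * l1tail n u <= lasso T y u)%E.
Proof.
move=> p0min TM zM u; rewrite /lasso (l1norm_head n).
have := l1tail_ge0 n u; case E : (l1tail n u) => [t||]// t0; last first.
  by rewrite !(addey, leey).
rewrite -EFinM -!EFinD lee_fin; rewrite lee_fin in t0.
set u0 := l2_embed p0; set z := residual T y u0.
have -> : u = u0 + (u - u0) by rewrite addrC subrK.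
rewrite lasso_smoothD -/u0 -/z (addrC u0) subrK.
have hE : u - u0 = l2_embed (l2_head n u - p0) + (u - l2_trunc n u).
  by rewrite l2_embedB l2_headK -/u0 [RHS]addrC subrKA.
have := lasso_fin_variational p0min (l2_head n u).
rewrite -/u0 -/z.
have -> : dotp z (T (u - u0)) = dotp z (T (l2_embed (l2_head n u - p0))) +
    dotp z (T (u - l2_trunc n u)) by rewrite hE mapLD dotpDr.
have : dotp z (T (u - l2_trunc n u)) <= 2^-1 * t.
  rewrite (le_trans (dotp_le _ _))//.
  rewrite (le_trans (ler_wpM2l (normr_ge0 z) (l1tail_bound TM E)))// mulrA.
  by rewrite ler_wpM2r.
rewrite /lasso_fin -/u0; set a := dotp z _; set b := dotp z _.
set c := rV_l1 _; set d := rV_l1 _; set W := `|_| ^+ 2; set Z := lasso_smooth _ _ _.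
move=> h1 h2; lra.
Qed.

(** Evaluated at any minimizer, the growth inequality forces its l^1 tail to vanish. Finite support
    is thus a property of every minimizer, not only of the one constructed. *)
Lemma lasso_argmin_head n T y (p0 : 'rV[R]_n) M :
  (forall p : 'rV[R]_n, lasso_fin T y p0 <= lasso_fin T y p) ->
  (forall i, (n <= i)%N -> `|T (l2_basis R i)| <= M) ->
  `|residual T y (l2_embed p0)| * M <= 2^-1 ->
  argmin setT (lasso T y) (l2_embed p0) /\
  forall u, argmin setT (lasso T y) u ->
    exists2 p : 'rV[R]_n, u = l2_embed p &
      (forall q : 'rV[R]_n, lasso_fin T y p <= lasso_fin T y q).
Proof.
move=> p0min TM zM; have G := lasso_growth p0min TM zM; split.
  split=> // u _; rewrite lasso_embed; apply: le_trans (G u).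
  rewrite [X in (_ <= X + _)%E]EFinD -addeA leeDl//.
  by rewrite adde_ge0 ?mule_ge0 ?l1tail_ge0 ?lee_fin.
move=> u [_ umin]; have uE : u = l2_embed (l2_head n u).
  apply: l1tail0_embed; apply/eqP; rewrite eq_le l1tail_ge0 andbT.
  have := le_trans (G u) (umin (l2_embed p0) I).
  rewrite lasso_embed [X in (X + _ <= _)%E]EFinD -addeA -[leRHS]adde0 leeD2lE//.
  case: (l1tail n u) (l1tail_ge0 n u) => [t||]//=; last first.
    by rewrite gt0_muley// ?addey// ?lte_fin ?invr_gt0.
  rewrite -EFinM -EFinD !lee_fin => t0.
  by have := sqr_ge0 `|Q (T (u - l2_embed p0))|; lra.
exists (l2_head n u) => // q; rewrite -lee_fin -!lasso_embed -uE.
exact: umin.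
Qed.

(** The value at 0 is 0, while coercivity makes the objective positive as soon as the l^1 norm
    exceeds [2 * M0]. It suffices to minimize over the sup-norm ball of that radius. *)
Lemma lasso_fin_min_ex n T y M0 :
  (forall p : 'rV[R]_n, - M0 + 2^-1 * rV_l1 p <= lasso_fin T y p) ->
  exists2 p0 : 'rV[R]_n, rV_l1 p0 <= 2 * M0 &
    (forall p : 'rV[R]_n, lasso_fin T y p0 <= lasso_fin T y p).
Proof.
move=> coer.
have fin0 : lasso_fin T y (0 : 'rV[R]_n) = 0.
  rewrite /lasso_fin l2_embed0 lasso_smooth0 add0r /rV_l1 big1// => i _.
  by rewrite mxE normr0.
have M00 : 0 <= M0.
  by have := coer 0; have := rV_l1_ge0 (0 : 'rV[R]_n); rewrite fin0; lra.
pose D := [set p : 'rV[R]_n | `|p| <= 2 * M0].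
have cD : compact D.
  apply: bounded_closed_compact.
    exists (2 * M0); split; first exact: num_real.
    by move=> x x0 p /= Dp; rewrite (le_trans Dp)// ltW.
  by apply: (@closed_comp _ _ (fun p : 'rV[R]_n => `|p|) [set x | x <= 2 * M0]);
    [move=> p _; exact: norm_continuous|exact: closed_le].
have D0 : D 0 by rewrite /D/= normr0 mulr_ge0.
have [p0 Dp0 p0min] : exists2 a, D a & forall b, D b -> lasso_fin T y a <= lasso_fin T y b.
  apply: compact_locally_lipschitz_min => [|//|p Dp]; first by exists 0.
  pose z := residual T y (l2_embed p).
  (* The three summands bound the variation of the linear term, of the quadratic term (by
     [e ^+ 2 <= e], as [e <= 1]) and of the l^1 norm. *)
  exists (`|z| * `|T| * n%:R + 2^-1 * (`|Q| * `|T| * n%:R) ^+ 2 + n%:R) => q Dq pq1.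
  set e := `|p - q|.
  have e0 : 0 <= e by exact: normr_ge0.
  have le1 : rV_l1 (q - p) <= n%:R * e by rewrite (le_trans (rV_l1_le_norm _))// distrC.
  have lee : `|l2_embed (q - p)| <= n%:R * e by exact: le_trans (norm_l2_embed _) le1.
  have -> : lasso_fin T y p - lasso_fin T y q =
      dotp z (T (l2_embed (q - p))) - 2^-1 * `|Q (T (l2_embed (q - p)))| ^+ 2 +
      (rV_l1 p - rV_l1 q).
    rewrite /lasso_fin -{1}(subrK p q) (addrC (q - p)) [l2_embed (p + _)]l2_embedD.
    rewrite lasso_smoothD -/z; ring.
  have h1 : `|dotp z (T (l2_embed (q - p)))| <= `|z| * `|T| * n%:R * e.
    rewrite (le_trans (dotp_cauchy_schwarz _ _))// -!mulrA ler_wpM2l//.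
    by rewrite (le_trans (ler_opnorm _ _))// ler_wpM2l.
  have h2 : `|2^-1 * `|Q (T (l2_embed (q - p)))| ^+ 2| <= 2^-1 * (`|Q| * `|T| * n%:R) ^+ 2 * e.
    rewrite ger0_norm ?mulr_ge0 ?sqr_ge0// -mulrA ler_wpM2l//.
    apply: (@le_trans _ _ ((`|Q| * `|T| * n%:R * e) ^+ 2)).
      rewrite ler_sqr ?nnegrE ?mulr_ge0// (le_trans (ler_opnorm _ _))//.
      rewrite -!mulrA ler_wpM2l// (le_trans (ler_opnorm _ _))//.
      by rewrite ler_wpM2l// mulrA.
    by rewrite exprMn ler_wpM2l ?sqr_ge0// expr2 ler_piMl.
  have h3 : `|rV_l1 p - rV_l1 q| <= n%:R * e.
    have a1 := rV_l1_triangle q (p - q); have a2 := rV_l1_triangle p (q - p).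
    have a3 : rV_l1 (p - q) = rV_l1 (q - p).
      by rewrite -opprB -scaleN1r rV_l1Z normrN1 mul1r.
    rewrite (addrC q) subrK a3 in a1; rewrite (addrC p) subrK in a2.
    by rewrite ler_norml; apply/andP; split; lra.
  rewrite !mulrDl (le_trans (ler_normD _ _))// lerD//.
  by rewrite (le_trans (ler_normB _ _))// lerD.
have p0minT (p : 'rV[R]_n) : lasso_fin T y p0 <= lasso_fin T y p.
  have [|pM] := leP `|p| (2 * M0); first exact: p0min.
  apply: (le_trans (p0min 0 D0)); rewrite fin0.
  have := coer p; have := norm_le_rV_l1 p; lra.
exists p0 => //; have := p0minT 0; rewrite fin0; have := coer p0; lra.
Qed.

End lasso.

(** * Estimates uniform over a compact set of operators *)

Lemma compact_norm_bounded (R : realType) (V : normedModType R) (A : set V) :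
  compact A -> exists2 b, 0 <= b & forall x, A x -> `|x| <= b.
Proof.
move=> cA; have [s [_ sP]] := compact_net cA ltr01.
exists (\sum_(z <- s) `|z| + 1) => [|x Ax]; first by rewrite addr_ge0// sumr_ge0.
have [z zs xz] := sP x Ax.
rewrite -(subrK z x) addrC (le_trans (ler_normD _ _))// lerD//; last exact: ltW.
by rewrite (perm_big _ (perm_to_rem zs)) big_cons lerDl sumr_ge0.
Qed.

(** Bessel's inequality without an adjoint: testing [T] on the sum of the [a i *: l2_basis R i]
    shows that the partial sums of [a i ^+ 2] stay below [(|T| |w|)^2], so [a i] tends to 0. *)
Lemma basis_weakly_null (R : realType) (Y : hilbertType R) (T : 'L(l2 R, Y))
    (w : Y) (e : R) :
  0 < e -> exists N, forall i, (N <= i)%N -> `|dotp (T (l2_basis R i)) w| <= e.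
Proof.
move=> e0; pose a i := dotp (T (l2_basis R i)) w.
pose s n := \sum_(i < n) a i ^+ 2.
have s_bound n : s n <= (`|T| * `|w|) ^+ 2.
  pose u : l2 R := \sum_(i < n) a i *: l2_basis R i.
  have uu : `|u| ^+ 2 = s n by exact: (l2_sum_basis_normsq (fun i : 'I_n => a i)).
  have Tu : dotp (T u) w = s n.
    rewrite /u (raddf_sum T) dotpC (raddf_sum (dotp w)).
    apply: eq_bigr => i _; rewrite -[LHS]/(dotp w (T (a i *: l2_basis R i))).
    by rewrite mapLZ dotpZr dotpC -expr2.
  have : `|u| ^+ 2 <= `|T| * `|w| * `|u|.
    rewrite uu -Tu (le_trans (dotp_le _ _))// mulrAC ler_wpM2r//.
    exact: ler_opnorm.
  have [u0|u0] := eqVneq `|u| 0; first by rewrite -uu u0 expr0n sqr_ge0.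
  rewrite expr2 ler_pM2r ?lt_def ?u0//= => h.
  by rewrite -uu ler_sqr ?nnegrE ?mulr_ge0.
pose c n := (`|T| * `|w|) ^+ 2 - s n.
have c0 n : 0 <= c n by rewrite subr_ge0.
have cS n : c n = c n.+1 + a n ^+ 2 by rewrite /c /s big_ord_recr/=; ring.
have cmono n m : (n <= m)%N -> c m <= c n.
  move=> nm; rewrite -(subnK nm); elim: (m - n)%N => // k IH.
  by rewrite addSn (le_trans _ IH)// (cS (k + n)%N) lerDl sqr_ge0.
have e20 : 0 < e ^+ 2 by rewrite exprn_gt0.
have [N NP] := nonincreasing_cauchy c0 cmono e20.
exists N => i Ni; rewrite -ler_sqr ?nnegrE ?(ltW e0)// real_normK ?num_real//.
rewrite -/(a i) (le_trans _ (NP i.+1 (leqW Ni)))//.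
have := cmono _ _ Ni; rewrite (cS i); lra.
Qed.

Section uniform_lasso.
Context (R : realType) (X : normedModType R) (Y : hilbertType R).
Context (S Q : 'L(Y, Y)) (K : 'L(X, Y)) (BB : set 'L(l2 R, X)).
Hypotheses (symS : forall a b, dotp (S a) b = dotp a (S b))
  (psdS : forall a, 0 <= dotp (S a) a) (injS : injective S)
  (symQ : forall a b, dotp (Q a) b = dotp a (Q b))
  (QQ : forall a, Q (Q a) = S a)
  (cK : compact_operator K) (cBB : compact BB) (BB0 : BB !=set0)
  (fbi : forall B, BB B -> finite_basis_injective (S \o K \o B)).

(** For a single [B], the images [K (B e_i)] tend weakly to 0 and lie in a relatively compact set,
    hence tend to 0 in norm. A finite net of [BB] makes this uniform. *)
Lemma compact_basis_tail (e : R) : 0 < e -> exists N, forall i, (N <= i)%N ->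
  forall B, BB B -> `|K (B (l2_basis R i))| <= e.
Proof.
move=> e0.
have single (B : 'L(l2 R, X)) d : 0 < d -> exists N, forall i, (N <= i)%N ->
    `|K (B (l2_basis R i))| <= d.
  move=> d0; pose b := `|B| + 1; have b0 : 0 < b by rewrite ltr_wpDl.
  have d1 : 0 < d / (2 * b) by rewrite divr_gt0// mulr_gt0.
  have [s sP] := compact_operator_net cK d1.
  have d2 : 0 < (d / b) * (d / 2) by rewrite !mulr_gt0// invr_gt0.
  have [N NP] : exists N, forall z, z \in s -> forall i, (N <= i)%N ->
      `|dotp (compL K B (l2_basis R i)) z| <= (d / b) * (d / 2).
    elim: s {sP} => [|z s [N NP]]; first by exists 0%N.
    have [M MP] := basis_weakly_null (compL K B) z d2.
    exists (maxn N M) => t; rewrite inE => /orP[/eqP ->|ts] i iN.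
      by rewrite MP// (leq_trans _ iN)// leq_maxr.
    by rewrite (NP t ts)// (leq_trans _ iN)// leq_maxl.
  exists N => i Ni; set v := K (B (l2_basis R i)).
  have bB : `|b^-1 *: B (l2_basis R i)| <= 1.
    rewrite normrZ gtr0_norm ?invr_gt0// ler_pdivrMl// mulr1.
    by rewrite (le_trans (ler_opnorm _ _))// l2_basis_norm mulr1 /b lerDl.
  have [z zs] := sP _ bB; rewrite mapLZ -/v => vz.
  have := NP z zs i Ni; rewrite compLE -/v => vz2.
  have : `|v| ^+ 2 <= `|v| * (d / 2) + d * (d / 2).
    (* [z] is a net point close to [b^-1 *: v]: the first product is small by proximity, the second
       by weak convergence. The tolerances [d1] and [d2] are such that [|v| > d] would give
       [|v|^2 < |v|^2]. *)
    have -> : `|v| ^+ 2 = b * dotp v (b^-1 *: v - z) + b * dotp v z.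
      by rewrite dotpBr dotpZr dotp_norm; field; rewrite gt_eqF.
    rewrite lerD//.
      apply: (@le_trans _ _ (b * (`|v| * (d / (2 * b))))).
        by rewrite ler_wpM2l ?(ltW b0)// (le_trans (dotp_le _ _))// ler_wpM2l// ltW.
      by rewrite le_eqVlt; apply/orP; left; apply/eqP; field; rewrite gt_eqF.
    apply: (@le_trans _ _ (b * ((d / b) * (d / 2)))).
      by rewrite ler_wpM2l ?(ltW b0)// (le_trans (ler_norm _)).
    by rewrite le_eqVlt; apply/orP; left; apply/eqP; field; rewrite gt_eqF.
  move=> h; rewrite leNgt; apply/negP => dv.
  have : `|v| * (d / 2) + d * (d / 2) < `|v| * `|v|.
    have v0 : 0 < `|v| by exact: lt_trans dv.
    have : d * (d / 2) < `|v| * (d / 2) by rewrite ltr_pM2r// divr_gt0.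
    have : `|v| * d < `|v| * `|v| by rewrite ltr_pM2l.
    lra.
  by rewrite -expr2 ltNge h.
pose k := `|K| + 1; have k0 : 0 < k by rewrite ltr_wpDl.
have e1 : 0 < e / (2 * k) by rewrite divr_gt0// mulr_gt0.
have e2 : 0 < e / 2 by rewrite divr_gt0.
have [s [_ sP]] := compact_net cBB e1.
have [N NP] : exists N, forall B, B \in s -> forall i, (N <= i)%N ->
    `|K (B (l2_basis R i))| <= e / 2.
  elim: s {sP} => [|B s [N NP]]; first by exists 0%N.
  have [M MP] := single B _ e2.
  exists (maxn N M) => t; rewrite inE => /orP[/eqP ->|ts] i iN.
    by rewrite MP// (leq_trans _ iN)// leq_maxr.
  by rewrite (NP t ts)// (leq_trans _ iN)// leq_maxl.
exists N => i Ni B /sP[B' B's BB'].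
have -> : K (B (l2_basis R i)) = K ((B - B') (l2_basis R i)) + K (B' (l2_basis R i)).
  by rewrite -mapLD subLE subrK.
rewrite (le_trans (ler_normD _ _))// [leRHS](splitr e) lerD ?(NP B')//.
rewrite (le_trans (ler_opnorm _ _))//.
apply: (@le_trans _ _ (k * (e / (2 * k)))); last first.
  by rewrite le_eqVlt; apply/orP; left; apply/eqP; field; rewrite gt_eqF.
rewrite ler_pM//; first by rewrite /k lerDl.
by rewrite (le_trans (ler_opnorm _ _))// l2_basis_norm mulr1 ltW.
Qed.

(* Writing [y = G^n y + S w] with [G = 1 - S / c], the term [<S w, K B u>] is
   absorbed by the quadratic term, and [<G^n y, K B u> = <y, G^n K B u>] is
   small because [G^n -> 0] uniformly on compact sets. *)
Lemma lasso_coercive (b r : R) : 0 <= b -> 0 <= r -> exists M, forall B : 'L(l2 R, X),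
  `|B| <= b -> forall y, `|y| <= r -> forall u t, `|u| <= t ->
  - M + 2^-1 * t <= lasso_smooth Q (compL K B) y u + t.
Proof.
move=> b0 r0; pose e := (2 * (r + 1) * (b + 1))^-1.
have e0 : 0 < e by rewrite invr_gt0 !mulr_gt0// ltr_wpDl.
have [n nP] := iter_relax_compact symS psdS injS cK e0.
exists (2^-1 * (`|Q| * (n%:R * r)) ^+ 2) => B Bb y yr u t ut.
have [w [yw wn]] := iter_relax_residual symS psdS n y.
have t0 : 0 <= t by exact: le_trans ut.
rewrite /lasso_smooth compLE; set v := K (B u).
have -> : dotp y v = dotp y (iter n (relax S) v) + dotp (Q w) (Q v).
  rewrite -{1}(subrK (iter n (relax S) y) y) dotpDl (iter_relax_sym symS) yw.
  by rewrite -QQ symQ addrC.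
have h1 : dotp y (iter n (relax S) v) <= 2^-1 * t.
  rewrite (le_trans (dotp_le _ _))//.
  apply: (@le_trans _ _ (r * (e * (b * t)))).
    rewrite ler_pM// (le_trans (nP _))// ler_wpM2l ?(ltW e0)//.
    by rewrite (le_trans (ler_opnorm _ _))// ler_pM.
  rewrite (_ : r * _ = (r * e * b) * t); last by ring.
  rewrite ler_wpM2r// /e (_ : _ * _ = (r * b) / (2 * (r + 1) * (b + 1))); last by ring.
  rewrite ler_pdivrMr ?mulr_gt0 ?ltr_wpDl//.
  have -> : 2^-1 * (2 * (r + 1) * (b + 1)) = (r + 1) * (b + 1) by field.
  by rewrite ler_pM ?lerDl.
have h2 : dotp (Q w) (Q v) <= 2^-1 * `|Q w| ^+ 2 + 2^-1 * `|Q v| ^+ 2.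
  by have := sqr_ge0 `|Q w - Q v|; rewrite normBsq; lra.
have h3 : `|Q w| ^+ 2 <= (`|Q| * (n%:R * r)) ^+ 2.
  rewrite ler_sqr ?nnegrE ?mulr_ge0// (le_trans (ler_opnorm _ _))// ler_wpM2l//.
  by rewrite (le_trans wn)// ler_wpM2l.
lra.
Qed.

Lemma QK_inj B n (p : 'rV[R]_n) : BB B -> Q (K (B (l2_embed p))) = 0 -> p = 0.
Proof.
move=> BBB h.
have e0 : l2_embed p = 0.
  apply: (fbi BBB (I := [fset i in iota 0 n]%fset)) => //.
  - exact/mem_set/l2_embed_span.
  - by rewrite -(l2_embed0 R n); exact/mem_set/l2_embed_span.
  - by rewrite /= -QQ h !mapL0.
by rewrite -(l2_embedK p) e0; apply/rowP => i; rewrite !mxE.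
Qed.

(** By compactness the infimum over [BB] and the unit sphere is attained, and [QK_inj] makes it
    positive. The minimum is taken first over the sphere, then over [BB], where the partial minimum
    [g] is Lipschitz. The sphere is empty only when 0 is the sole vector. *)
Lemma uniform_injectivity n : exists2 c, 0 < c & forall B, BB B ->
  forall p : 'rV[R]_n, c * `|l2_embed p| ^+ 2 <= `|Q (K (B (l2_embed p)))| ^+ 2.
Proof.
pose F (B : 'L(l2 R, X)) (p : 'rV[R]_n) := `|Q (K (B (l2_embed p)))|.
pose D := [set p : 'rV[R]_n | `|p| = 1].
have le_embed (p : 'rV[R]_n) : `|l2_embed p| <= n%:R * `|p|.
  exact: le_trans (norm_l2_embed _) (rV_l1_le_norm _).
have [D0|D0] := pselect (D !=set0); last first.
  exists 1 => // B _ p; have [->|p0] := eqVneq p 0.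
    by rewrite l2_embed0 !mapL0 !normr0 expr0n mulr0.
  by exfalso; apply: D0; exists (`|p|^-1 *: p); rewrite /D/= normfZV.
have cD : compact D.
  apply: bounded_closed_compact.
    exists 1; split; first exact: num_real.
    by move=> x x1 p /= ->; rewrite ltW.
  by apply: (@closed_comp _ _ (fun p : 'rV[R]_n => `|p|) [set x | x = 1]);
    [move=> p _; exact: norm_continuous|exact: closed_eq].
have Fdiff (B B' : 'L(l2 R, X)) (p q : 'rV[R]_n) :
    `|Q (K (B (l2_embed p))) - Q (K (B' (l2_embed q)))| <=
   `|Q| * `|K| * (`|B| * (n%:R * `|p - q|) + `|B - B'| * (n%:R * `|q|)).
  rewrite -!mapLB (le_trans (ler_opnorm _ _))// -mulrA ler_wpM2l//.
  rewrite (le_trans (ler_opnorm _ _))// ler_wpM2l//.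
  have -> : B (l2_embed p) - B' (l2_embed q) =
      B (l2_embed (p - q)) + (B - B') (l2_embed q).
    by rewrite l2_embedB mapLB subLE subrKA.
  rewrite (le_trans (ler_normD _ _))// lerD//.
    by rewrite (le_trans (ler_opnorm _ _))// ler_wpM2l.
  by rewrite (le_trans (ler_opnorm _ _))// ler_wpM2l.
have minB (B : 'L(l2 R, X)) : exists p, D p /\ forall q, D q -> F B p <= F B q.
  have [p Dp pmin] : exists2 a, D a & forall b, D b -> F B a <= F B b.
    apply: compact_locally_lipschitz_min => // p Dp.
    exists (`|Q| * `|K| * (`|B| * n%:R)) => q Dq _.
    rewrite (le_trans (ler_dist_dist _ _))// (le_trans (Fdiff _ _ _ _))//.
    by rewrite subrr normr0 mul0r addr0 -!mulrA.
  by exists p.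
have [pB pBP] := choice minB; pose g B := F B (pB B).
have gle (B B' : 'L(l2 R, X)) : g B - g B' <= `|Q| * `|K| * n%:R * `|B - B'|.
  have [DpB' _] := pBP B'; have [_ /(_ _ DpB') h] := pBP B.
  rewrite (@le_trans _ _ (F B (pB B') - g B'))// ?lerB//.
  rewrite (le_trans (lerB_dist _ _))// (le_trans (Fdiff _ _ _ _))//.
  rewrite subrr normr0 !mulr0 add0r DpB' mulr1 -!mulrA (mulrC n%:R)//.
have [B0 BB0' B0min] : exists2 a, BB a & forall b, BB b -> g a <= g b.
  apply: compact_locally_lipschitz_min => // B BBB.
  exists (`|Q| * `|K| * n%:R) => B' BBB' _.
  by rewrite ler_norml gle andbT lerNl opprB distrC gle.
have g0 : 0 < g B0.
  rewrite lt_def normr_ge0 andbT normr_eq0; apply/eqP => /(QK_inj BB0') p0.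
  have [] := pBP B0; rewrite p0 /D/= normr0 => /eqP; rewrite eq_sym oner_eq0.
  by [].
(* [F] is minimized on the sup-norm sphere; [n.+1] dominates the factor [n] by which the l^2 norm
   can exceed the sup norm. *)
exists ((g B0 / n.+1%:R) ^+ 2); first by rewrite exprn_gt0// divr_gt0.
move=> B BBB p; rewrite -exprMn ler_sqr ?nnegrE ?mulr_ge0 ?divr_ge0 ?(ltW g0)//.
have [->|p0] := eqVneq p 0; first by rewrite l2_embed0 !mapL0 normr0 mulr0.
have Dp : D (`|p|^-1 *: p) by rewrite /D/= normfZV.
have pp : 0 < `|p| by rewrite normr_gt0.
have [_ /(_ _ Dp)] := pBP B; rewrite -/(g B) /F l2_embedZ !mapLZ normrZ.
rewrite ger0_norm ?invr_ge0// => h.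
have {h} := le_trans (B0min _ BBB) h; rewrite ler_pdivlMl// => h.
apply: le_trans h; rewrite mulrAC ler_pdivrMr// mulrC (mulrC _ (g B0)) -mulrA mulrC.
rewrite [leLHS]mulrC [leRHS]mulrCA ler_wpM2l ?(ltW g0)//.
by rewrite (le_trans (le_embed p))// mulrC ler_wpM2l// ler_nat.
Qed.

(** The bound [2 * M0] on minimizers comes from coercivity and is independent of [n]. This allows
    [n] to be chosen last, so that beyond it the basis images are small compared with every residual
    that can occur. *)
Lemma lasso_argmin_uniform (r : R) : 0 <= r -> exists n M, forall B, BB B ->
  forall y, `|y| <= r ->
  argmin setT (lasso Q (compL K B) y) !=set0 /\
  forall u, argmin setT (lasso Q (compL K B) y) u ->
  exists p : 'rV[R]_n, [/\ u = l2_embed p, `|u| <= M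
    & forall q : 'rV[R]_n, lasso_fin Q (compL K B) y p +
        2^-1 * `|Q (K (B (l2_embed q - l2_embed p)))| ^+ 2 <=
        lasso_fin Q (compL K B) y q].
Proof.
move=> r0; have [b b0 bP] := compact_norm_bounded cBB.
have [M0 M0P] := lasso_coercive b0 r0.
(* [r'] bounds the residual at any point of l^1 norm at most [2 * M0]; the absolute value keeps it
   nonnegative before the sign of [M0] is known. *)
pose r' := r + `|Q| * (`|Q| * (`|K| * (b * `|2 * M0|))).
have r'0 : 0 <= r' by rewrite addr_ge0// !mulr_ge0.
have e0 : 0 < (2 * (r' + 1))^-1 by rewrite invr_gt0 mulr_gt0// ltr_wpDl.
have [n nP] := compact_basis_tail e0.
exists n, (2 * M0) => B BBB y yr; set T := compL K B.
have coer (p : 'rV[R]_n) : - M0 + 2^-1 * rV_l1 p <= lasso_fin Q T y p.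
  by apply: M0P => //; [exact: bP|exact: norm_l2_embed].
have minle (p : 'rV[R]_n) :
    (forall q : 'rV[R]_n, lasso_fin Q T y p <= lasso_fin Q T y q) ->
    rV_l1 p <= 2 * M0.
  move=> /(_ 0); rewrite {2}/lasso_fin l2_embed0 lasso_smooth0 add0r.
  have -> : rV_l1 (0 : 'rV[R]_n) = 0 by rewrite /rV_l1 big1// => i _; rewrite mxE normr0.
  by have := coer p; lra.
have TM i : (n <= i)%N -> `|T (l2_basis R i)| <= (2 * (r' + 1))^-1.
  by move=> ni; exact: nP.
have zM (p : 'rV[R]_n) : rV_l1 p <= 2 * M0 ->
    `|residual Q T y (l2_embed p)| * (2 * (r' + 1))^-1 <= 2^-1.
  move=> pM; rewrite ler_pdivrMr ?mulr_gt0 ?ltr_wpDl//.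
  rewrite (_ : 2^-1 * _ = r' + 1); last by field.
  apply: (@le_trans _ _ r'); last by rewrite lerDl.
  rewrite /residual (le_trans (ler_normB _ _))// lerD//.
  rewrite (le_trans (ler_opnorm _ _))// ler_wpM2l//.
  rewrite (le_trans (ler_opnorm _ _))// ler_wpM2l// /T compLE.
  rewrite (le_trans (ler_opnorm _ _))// ler_wpM2l//.
  rewrite (le_trans (ler_opnorm _ _))// ler_pM ?bP//.
  by rewrite (le_trans (norm_l2_embed _))// (le_trans pM)// ler_norm.
have [p0 p0M p0min] := lasso_fin_min_ex symQ coer.
have [ex head] := lasso_argmin_head symQ p0min TM (zM _ p0M).
split; first by exists (l2_embed p0).
move=> u /head[p -> pmin]; have pM := minle _ pmin.
exists p; split=> //; first exact: le_trans (norm_l2_embed _) pM.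
move=> q; have := lasso_growth symQ pmin TM (zM _ pM) (l2_embed q).
by rewrite lasso_embed l1tail_embed mule0 adde0 lee_fin.
Qed.

(** Each growth inequality is evaluated at the minimizer of the other problem and the two are added,
    which removes the l^1 norms. What remains bounds a quadratic form in [d = u2 - u1] by a change
    of gradient applied to [d]. Both minimizers live on the same [n] coordinates, so
    [uniform_injectivity] applies to [d]. *)
Lemma lasso_argmin_lipschitz (r : R) : 0 <= r -> exists L M, [/\ 0 <= L, 0 <= M &
  forall B1 B2 y1 y2 u1 u2, BB B1 -> BB B2 -> `|y1| <= r -> `|y2| <= r ->
  argmin setT (lasso Q (compL K B1) y1) u1 ->
  argmin setT (lasso Q (compL K B2) y2) u2 ->
  `|u1| <= M /\ `|u1 - u2| <= L * (`|B1 - B2| + `|y1 - y2|)].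
Proof.
move=> r0; have [b b0 bP] := compact_norm_bounded cBB.
have [n [M' nM]] := lasso_argmin_uniform r0.
have [c c0 cP] := uniform_injectivity n.
pose M := `|M'|; pose k := `|K|; pose s := `|Q| * `|Q| * k.
pose r' := r + s * b * M.
pose L0 := k * b + s * M * k * b + r' * k.
have k0 : 0 <= k by exact: normr_ge0.
have s0 : 0 <= s by rewrite !mulr_ge0.
have M00 : 0 <= M by exact: normr_ge0.
have r'0 : 0 <= r' by rewrite addr_ge0// !mulr_ge0.
have L00 : 0 <= L0 by rewrite !addr_ge0// !mulr_ge0.
exists (L0 / c), M; split=> //; first by rewrite divr_ge0// ltW.
move=> B1 B2 y1 y2 u1 u2 BB1 BB2 y1r y2r min1 min2.
have [_ /(_ _ min1)[p1 [u1E u1M' g1]]] := nM _ BB1 _ y1r.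
have [_ /(_ _ min2)[p2 [u2E u2M' g2]]] := nM _ BB2 _ y2r.
have u1M : `|u1| <= M by rewrite (le_trans u1M')// ler_norm.
split=> //.
set T1 := compL K B1 in g1; set T2 := compL K B2 in g2.
have {}g1 := g1 p2; have {}g2 := g2 p1.
pose d := u2 - u1; have u2d : u2 = u1 + d by rewrite /d addrC subrK.
pose z1 := residual Q T1 y1 u1; pose z2 := residual Q T2 y2 u1.
(* Both smooth parts are expanded at [u1], so [z1] and [z2] differ only through the data. The
   quadratic term of the first problem cancels against its growth term. *)
have key : `|Q (K (B2 d))| ^+ 2 <= dotp z2 (T2 d) - dotp z1 (T1 d).
  move: g1 g2; rewrite /lasso_fin -u1E -u2E -/d u2d.
  rewrite !(lasso_smoothD symQ) -/z1 -/z2.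
  have -> : `|Q (K (B2 (u1 - (u1 + d))))| = `|Q (K (B2 d))|.
    by rewrite opprD addrA subrr add0r !mapLN normrN.
  rewrite -/(T1 d) -/(T2 d).
  have -> : K (B1 d) = T1 d by []. 
  have -> : K (B2 d) = T2 d by [].
  lra.
set D := `|B1 - B2| + `|y1 - y2|.
have D0 : 0 <= D by rewrite addr_ge0.
have TD : T2 d - T1 d = K ((B2 - B1) d).
  by rewrite -[RHS]/(K (B2 d - B1 d)) (mapLB K).
have bound : dotp z2 (T2 d) - dotp z1 (T1 d) <= L0 * D * `|d|.
  have -> : dotp z2 (T2 d) - dotp z1 (T1 d) =
      dotp (z2 - z1) (T2 d) + dotp z1 (T2 d - T1 d).
    by rewrite dotpBl dotpBr; ring.
  have zz : `|z2 - z1| <= (1 + s * M) * D.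
    have -> : z2 - z1 = (y2 - y1) - Q (Q (K ((B2 - B1) u1))).
      rewrite /z2 /z1 /residual subLE !mapLB.
      rewrite !opprB addrACA [RHS]addrACA; congr (_ + _); exact: addrC.
    rewrite (le_trans (ler_normB _ _))// mulrDl mul1r lerD//.
      by rewrite distrC /D lerDr.
    rewrite (le_trans (ler_opnorm _ _))// /s /k -!mulrA ler_wpM2l//.
    rewrite (le_trans (ler_opnorm _ _))// ler_wpM2l//.
    rewrite (le_trans (ler_opnorm _ _))// ler_wpM2l//.
    rewrite (le_trans (ler_opnorm _ _))// mulrC ler_pM//.
    by rewrite distrC /D lerDl.
  have T2d : `|T2 d| <= k * b * `|d|.
    rewrite /T2 compLE (le_trans (ler_opnorm _ _))// -mulrA ler_wpM2l//.
    by rewrite (le_trans (ler_opnorm _ _))// ler_wpM2r// bP.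
  have z1r : `|z1| <= r'.
    rewrite (le_trans (ler_normB _ _))// lerD//.
    rewrite (le_trans (ler_opnorm _ _))// /s /k -!mulrA ler_wpM2l//.
    rewrite (le_trans (ler_opnorm _ _))// ler_wpM2l// /T1 compLE.
    rewrite (le_trans (ler_opnorm _ _))// ler_wpM2l//.
    by rewrite (le_trans (ler_opnorm _ _))// ler_pM ?bP.
  have TDd : `|T2 d - T1 d| <= k * (D * `|d|).
    rewrite TD (le_trans (ler_opnorm _ _))// ler_wpM2l//.
    rewrite (le_trans (ler_opnorm _ _))// ler_wpM2r//.
    by rewrite distrC /D lerDl.
  apply: (@le_trans _ _ ((1 + s * M) * D * (k * b * `|d|) + r' * (k * (D * `|d|)))).
    by rewrite lerD// (le_trans (dotp_le _ _))// ler_pM.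
  by rewrite le_eqVlt; apply/orP; left; apply/eqP; rewrite /L0; ring.
have cd : c * `|d| ^+ 2 <= L0 * D * `|d|.
  have := cP _ BB2 (p2 - p1); rewrite l2_embedB -u1E -u2E -/d => h.
  exact: le_trans h (le_trans key bound).
have [d0|d0] := eqVneq `|d| 0.
  by rewrite distrC -/d d0 mulr_ge0// divr_ge0// ltW.
rewrite distrC -/d mulrAC ler_pdivlMr// mulrC.
have dp : 0 < `|d| by rewrite lt_def d0 /=.
by rewrite -(ler_pM2r dp) -mulrA -expr2.
Qed.

End uniform_lasso.

(** * Hoeffding's inequality *)

Import HBNNSimple.

(** From [expR (- x) >= 1 - x] one gets [expR x <= 1 / (1 - x)]. The crude coefficient 2 leads to
    the denominator [8 V^2 = 32 M^2] in [hoeffding_tail]. *)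
Lemma expR_le_quadratic (R : realType) (x : R) : `|x| <= 2^-1 ->
  expR x <= 1 + x + 2 * x ^+ 2.
Proof.
rewrite ler_norml => /andP[x1 x2].
have x0 : 0 < 1 - x by lra.
have h : 1 - x <= expR (- x) by exact: expR_ge1Dx.
rewrite -[expR x]invrK -expRN; apply: (@le_trans _ _ (1 - x)^-1).
  by rewrite lef_pV2 ?posrE ?expR_gt0.
rewrite -[(1 - x)^-1]mul1r ler_pdivrMr// -subr_ge0.
rewrite (_ : _ - _ = x ^+ 2 * (1 - 2 * x)); last by ring.
by rewrite mulr_ge0 ?sqr_ge0// subr_ge0; lra.
Qed.

(** * Expectations of products of independent factors *)

Section independence.
Context (R : realType) d (Om : measurableType d) (P : probability Om R)
  d' (E : measurableType d').
Local Open Scope ereal_scope.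

Section factor.
Context (Z : Om -> E) (mZ : measurable_fun setT Z).

Let measurable_weight (V : Om -> R) (h : E -> R) :
  measurable_fun setT V -> measurable_fun setT h ->
  measurable_fun setT (EFin \o (fun w => h (Z w) * V w)%R).
Proof.
by move=> mV mh; apply/measurable_EFinP/measurable_funM => //; exact: measurableT_comp.
Qed.

Let integral_simple (V : Om -> R) (h : {nnsfun E >-> R}) :
  measurable_fun setT V -> (forall w, 0 <= V w)%R ->
  \int[P]_w (h (Z w) * V w)%:E =
  \sum_(i < #|` fset_set (range h)|) ((fset_set (range h))`_i)%R%:E *
    \int[P]_w (\1_(h @^-1` [set ((fset_set (range h))`_i)%R]) (Z w) * V w)%:E.
Proof.
move=> mV V0.
have s0 (i : 'I_#|` fset_set (range h)|) : (0 <= ((fset_set (range h))`_i)%R)%R.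
  have : ((fset_set (range h))`_i)%R \in fset_set (range h) by exact: mem_nth.
  by rewrite in_fset_set// inE => -[z _ <-].
set s := fset_set (range h) in s0 *; pose D i := h @^-1` [set s`_i%R].
have mD i : measurable (D i).
  by apply: measurable_funPTI; exact: measurable_set1.
have mDV i : measurable_fun setT (EFin \o (fun w => \1_(D i) (Z w) * V w)%R).
  by apply: measurable_weight => //; exact: measurable_indic.
transitivity (\int[P]_w (\sum_(i < #|` s|) (s`_i)%R%:E * (\1_(D i) (Z w) * V w)%:E)).
  apply: eq_integral => w _; rewrite fimfunEord mulr_suml -sumEFin.
  by apply: eq_bigr => i _; rewrite -mulrA EFinM.
rewrite ge0_integral_sum//.
- apply: eq_bigr => i _; rewrite ge0_integralZl_EFin//.
    by move=> w _; rewrite lee_fin mulr_ge0.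
  exact: mDV.
- by move=> i; apply: measurable_funeM; exact: mDV.
- by move=> i w _; rewrite -EFinM lee_fin !mulr_ge0.
Qed.

Let integral_approx (V : Om -> R) (g : E -> R) (mg : measurable_fun setT (EFin \o g)) :
  measurable_fun setT V -> (forall w, 0 <= V w)%R -> (forall z, 0 <= g z)%R ->
  \int[P]_w (nnsfun_approx measurableT mg n (Z w) * V w)%:E @[n --> \oo] -->
  \int[P]_w (g (Z w) * V w)%:E.
Proof.
move=> mV V0 g0; pose g_ := nnsfun_approx measurableT mg.
have cvgw w : (fun n => (g_ n (Z w) * V w)%:E) @ \oo --> (g (Z w) * V w)%:E.
  under eq_fun do rewrite EFinM; rewrite EFinM; apply: cvgeZr => //.
  by apply: (@cvg_nnsfun_approx _ _ _ _ measurableT _ mg) => // z _; rewrite lee_fin.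
have -> : \int[P]_w (g (Z w) * V w)%:E =
    \int[P]_w (limn (fun n => (g_ n (Z w) * V w)%:E)).
  by apply: eq_integral => w _; apply/esym/cvg_lim.
apply: cvg_monotone_convergence => //.
- by move=> n; apply: measurable_weight.
- by move=> n w _; rewrite lee_fin mulr_ge0.
- move=> w _ a b ab; rewrite lee_fin ler_wpM2r//.
  exact/lefP/nd_nnsfun_approx.
Qed.

(** The hypothesis is the factorization for indicators. Linearity extends it to simple functions,
    and monotone convergence to nonnegative [g]. *)
Lemma integral_factor (W : Om -> R) (c : R) (g : E -> R) :
  measurable_fun setT W -> (forall w, 0 <= W w)%R -> (0 <= c)%R ->
  (forall D, measurable D -> \int[P]_w (\1_D (Z w) * W w)%:E =
    P (Z @^-1` D) * c%:E) ->
  measurable_fun setT g -> (forall z, 0 <= g z)%R ->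
  \int[P]_w (g (Z w) * W w)%:E = (\int[P]_w (g (Z w))%:E) * c%:E.
Proof.
move=> mW W0 c0 indep mg g0.
have mg' : measurable_fun setT (EFin \o g) by exact/measurable_EFinP.
pose V1 := cst 1%R : Om -> R.
have simple (h : {nnsfun E >-> R}) : \int[P]_w (h (Z w) * W w)%:E =
    (\int[P]_w (h (Z w) * V1 w)%:E) * c%:E.
  rewrite (@integral_simple W)// (@integral_simple V1)//.
  rewrite ge0_sume_distrl; last first.
    move=> i _; rewrite mule_ge0// ?integral_ge0// => [|w _]; last first.
      by rewrite lee_fin mulr_ge0// ler01.
    have : ((fset_set (range h))`_i)%R \in fset_set (range h) by exact: mem_nth.
    by rewrite lee_fin in_fset_set// inE => -[z _ <-].
  apply: eq_bigr => i _; rewrite -muleA; congr (_ * _).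
  have mD : measurable (h @^-1` [set ((fset_set (range h))`_i)%R]).
    by apply: measurable_funPTI; exact: measurable_set1.
  rewrite indep//; congr (_ * _).
  transitivity (\int[P]_w (\1_(Z @^-1` (h @^-1` [set ((fset_set (range h))`_i)%R])) w)%:E).
    rewrite integral_indic// ?setIT//.
    by rewrite -[X in measurable X]setTI; exact: mZ.
  by apply: eq_integral => w _; rewrite mulr1 !indicE.
have -> : \int[P]_w (g (Z w))%:E = \int[P]_w (g (Z w) * V1 w)%:E.
  by apply: eq_integral => w _; rewrite mulr1.
apply: (@cvg_unique _ (@ereal_hausdorff R)
  ((fun n => \int[P]_w (nnsfun_approx measurableT mg' n (Z w) * W w)%:E) @ \oo)).
  exact: integral_approx.
rewrite [X in X @ _](_ : _ = fun n =>
    (\int[P]_w (nnsfun_approx measurableT mg' n (Z w) * V1 w)%:E) * c%:E); last first.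
  by apply/funext => n; exact: simple.
by apply: cvgeZr => //; apply: integral_approx => // w; exact: ler01.
Qed.

End factor.

Lemma prod_indic (I : finType) (D : I -> set Om) w :
  (\prod_(i in I) \1_(D i) w = \1_(\bigcap_i D i) w :> R)%R.
Proof.
rewrite indicE; case: (boolP (w \in \bigcap_i D i)) => [|wD].
  by rewrite inE => Dw; rewrite big1// => i _; rewrite indicE mem_set//; exact: Dw.
have [i wi] : exists i, w \notin D i.
  apply: contrapT => /forallNP h; move/negP: wD; apply; rewrite inE => i _.
  by have /negP := h i; rewrite negbK inE.
by rewrite (bigD1 i)//= indicE (negbTE wi) mul0r.
Qed.

(** Induction on the number [k] of leading factors allowed to be arbitrary, all others being
    indicators; [k = 0] is independence itself. In the step, factor [k] is replaced by an indicator
    and [integral_factor] restores it. The condition [1 <= K] lets indicators obey the common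
    bound. *)
Lemma integral_prod_indep (m : nat) (Z : 'I_m -> Om -> E) (K : R) :
  (forall j, measurable_fun setT (Z j)) ->
  (forall D : 'I_m -> set E, (forall j, measurable (D j)) ->
    P (\bigcap_j (Z j @^-1` D j)) = \prod_(j < m) P (Z j @^-1` D j)) ->
  forall G : 'I_m -> E -> R, (forall j, measurable_fun setT (G j)) ->
  (1 <= K)%R -> (forall j z, 0 <= G j z <= K)%R ->
  \int[P]_w (\prod_(j < m) G j (Z j w))%:E =
  (\prod_(j < m) fine (\int[P]_w (G j (Z j w))%:E))%:E.
Proof.
move=> mZ indep.
have mGZ (G : E -> R) j : measurable_fun setT G ->
    measurable_fun setT (fun w => G (Z j w)).
  by move=> mG; exact: measurableT_comp.
move=> G mG K1 GK; suff H k : (k <= m)%N -> forall G : 'I_m -> E -> R,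
    (forall j, measurable_fun setT (G j)) -> (forall j z, 0 <= G j z <= K)%R ->
    (forall j : 'I_m, (k <= j)%N -> exists2 D, measurable D & G j = \1_D) ->
    \int[P]_w (\prod_(j < m) G j (Z j w))%:E =
    (\prod_(j < m) fine (\int[P]_w (G j (Z j w))%:E))%:E.
  by apply: (H m) => // j; rewrite leqNgt ltn_ord.
elim: k {G mG GK} => [_ G mG GK Gind|k IH km G mG GK Gind].
  have /choice[D DP] : forall j : 'I_m, exists D, measurable D /\ G j = \1_D.
    by move=> j; have [D] := Gind j (leq0n _); exists D.
  under eq_integral => w _.
    rewrite (eq_bigr (fun j => \1_(Z j @^-1` D j) w)); last first.
      by move=> j _; rewrite (DP j).2 !indicE.
    rewrite prod_indic; over.
  rewrite integral_indic//; last first.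
    apply: fin_bigcap_measurable => // j _.
    by rewrite -[X in measurable X]setTI; apply: mZ => //; exact: (DP j).1.
  rewrite setIT; transitivity (\prod_(j < m) P (Z j @^-1` D j)).
    by apply: indep => j; exact: (DP j).1.
  rewrite -prodEFin; apply: eq_bigr => j _.
  have mZD : measurable (Z j @^-1` D j).
    by rewrite -[X in measurable X]setTI; apply: mZ => //; exact: (DP j).1.
  rewrite (DP j).2 [X in fine X](_ : _ = P (Z j @^-1` D j)).
    by rewrite fineK// fin_num_measure.
  by rewrite -[X in P X]setIT -integral_indic.
have finGZ j : \int[P]_w (G j (Z j w))%:E \is a fin_num.
  apply: integrable_fin_num => //; apply: measurable_bounded_integrable => //.
  - by apply: le_lt_trans (probability_le1 P measurableT) _; rewrite ltry.
  - exact: mGZ.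
  - exists K; split; first exact: num_real.
    move=> x Kx w _ /=; have /andP[G0 GK'] := GK j (Z j w).
    by rewrite ger0_norm// (le_trans GK')// ltW.
pose jk := Ordinal km.
have G0 j z : (0 <= G j z)%R by have /andP[] := GK j z.
pose W w := (\prod_(j < m | j != jk) G j (Z j w))%R.
pose c := (\prod_(j < m | j != jk) fine (\int[P]_w (G j (Z j w))%:E))%R.
have WE w : (\prod_(j < m) G j (Z j w) = G jk (Z jk w) * W w)%R by rewrite (bigD1 jk).
under eq_integral do rewrite WE.
rewrite (bigD1 jk)//= -/c EFinM fineK//.
apply: integral_factor => //.
- rewrite /W; under eq_fun do rewrite -big_filter.
  by apply: measurable_prod => j _; exact: mGZ.
- by move=> w; apply: prodr_ge0.
- by apply: prodr_ge0 => j _; apply: fine_ge0; apply: integral_ge0 => w _; rewrite lee_fin.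
- move=> D mD; pose G' j := if j == jk then \1_D else G j : E -> R.
  have mZD : measurable (Z jk @^-1` D).
    by rewrite -[X in measurable X]setTI; apply: mZ.
  have W' w : (\1_D (Z jk w) * W w = \prod_(j < m) G' j (Z j w))%R.
    rewrite (bigD1 jk)//= {1}/G' eqxx; congr (_ * _)%R.
    by apply: eq_bigr => j /negbTE jjk; rewrite /G' jjk.
  under eq_integral do rewrite W'.
  rewrite (IH (ltnW km)).
  + rewrite (bigD1 jk)//= EFinM; congr (_ * _%:E).
      rewrite /G' eqxx [X in fine X](_ : _ = P (Z jk @^-1` D)).
        by rewrite fineK// fin_num_measure.
      by rewrite -[X in P X]setIT -integral_indic.
    by apply: eq_bigr => j /negbTE jjk; rewrite /G' jjk.
  + by move=> j; rewrite /G'; case: ifP => _; [exact: measurable_indic|exact: mG].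
  + move=> j z; rewrite /G'; case: ifP => _; last exact: GK.
    by rewrite indicE; case: (_ \in _); rewrite ?ler01 ?lexx//= (le_trans ler01).
  + move=> j kj; rewrite /G'; case: eqP => [_|/eqP jjk]; first by exists D.
    apply: Gind; rewrite ltn_neqAle kj andbT; apply: contra jjk => /eqP kj'.
    by apply/eqP/val_inj.
Qed.

End independence.

Section hoeffding.
Context (R : realType) d (Om : measurableType d) (P : probability Om R)
  d' (E : measurableType d') (rho : probability E R).

Lemma bounded_integrable (f : E -> R) (M : R) : measurable_fun setT f ->
  (forall z, `|f z| <= M) -> rho.-integrable setT (EFin \o f).
Proof.
move=> mf fM; apply: measurable_bounded_integrable => //.
  by apply: le_lt_trans (probability_le1 rho measurableT) _; rewrite ltry.
exists M; split; first exact: num_real.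
by move=> x Mx z _ /=; rewrite (le_trans (fM z))// ltW.
Qed.

(** The integrand is majorized by an affine function of [f]; centering kills its linear part, which
    leaves [1 + 2 (l V)^2]. *)
Lemma exp_moment (f : E -> R) (M V l : R) : measurable_fun setT f ->
  (forall z, `|f z| <= M) ->
  (forall z, `|f z - fine (\int[rho]_z (f z)%:E)| <= V) -> 0 <= l ->
  l * V <= 2^-1 ->
  (\int[rho]_z (expR (l * (f z - fine (\int[rho]_z (f z)%:E))))%:E <=
   (expR (2 * (l * V) ^+ 2))%:E)%E.
Proof.
move=> mf fM; set mu := fine _ => fV l0 lV.
have intf := bounded_integrable mf fM.
pose a := 1 + 2 * (l * V) ^+ 2 - l * mu.
have aff z : expR (l * (f z - mu)) <= a + l * f z.
  have lfV : `|l * (f z - mu)| <= l * V by rewrite normrM ger0_norm// ler_wpM2l.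
  rewrite (le_trans (expR_le_quadratic (le_trans lfV lV)))//.
  have h : (l * (f z - mu)) ^+ 2 <= (l * V) ^+ 2.
    by rewrite -real_normK ?num_real// ler_sqr ?nnegrE// (le_trans _ lfV).
  by rewrite /a; lra.
apply: (@le_trans _ _ (\int[rho]_z (a + l * f z)%:E)%E).
  apply: ge0_le_integral => //.
  - apply/measurable_EFinP; apply: measurableT_comp => //.
    by apply: measurable_funM => //; exact: measurable_funB.
  - by apply/measurable_EFinP; apply: measurable_funD => //; exact: measurable_funM.
  - by move=> z _; rewrite lee_fin.
rewrite (_ : (fun z => (a + l * f z)%:E) = (fun z => a%:E + l%:E * (f z)%:E)%E); last first.
  by apply/funext => z; rewrite EFinD EFinM.
have icst : rho.-integrable setT (fun=> a%:E) by exact: finite_measure_integrable_cst.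
rewrite integralD//; last exact: integrableZl.
rewrite integralZl// integral_cst//.
rewrite [X in (_ * X + _ <= _)%E](_ : _ = 1%E) ?mule1; last exact: probability_setT.
rewrite -[X in (_ + _ * X)%E]fineK; last exact: integrable_fin_num.
rewrite -/mu -EFinM -EFinD lee_fin /a subrK; exact: expR_ge1Dx.
Qed.

Lemma hoeffding_tail (m : nat) (Z : 'I_m -> {RV P >-> E}) (f : E -> R) (M t : R) :
  (0 < m)%N -> (forall j D, measurable D -> P (Z j @^-1` D) = rho D) ->
  (forall D : 'I_m -> set E, (forall j, measurable (D j)) ->
    P (\bigcap_j (Z j @^-1` D j)) = (\prod_(j < m) P (Z j @^-1` D j))%E) ->
  measurable_fun setT f -> 0 < M -> (forall z, `|f z| <= M) -> 0 < t ->
  (P [set w | (m%:R * t <= \sum_(j < m)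
     (f (Z j w) - fine (\int[rho]_z (f z)%:E)%E))%R] <=
   (expR (- (m%:R * t ^+ 2 / (32 * M ^+ 2))))%:E)%E.
Proof.
move=> m0 law indep mf M0 fM t0; set mu := fine _.
have mZ j : measurable_fun setT (Z j) by exact: measurable_funPT.
have muM : `|mu| <= M.
  have cst_int (c : R) : rho.-integrable setT (EFin \o (fun=> c)).
    exact: finite_measure_integrable_cst.
  have Mcst (c : R) : Rintegral rho setT (fun=> c) = c.
    rewrite Rintegral_cst// [X in fine X](_ : _ = 1%E) ?mulr1//.
    exact: probability_setT.
  rewrite ler_norml -[X in X <= _](Mcst (- M)) -[X in _ && (_ <= X)](Mcst M).
  have intf := bounded_integrable mf fM.
  by apply/andP; split; apply: le_Rintegral => // z _; have := fM z;
    rewrite ler_norml => /andP[].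
pose V := 2 * M; have V0 : 0 < V by rewrite mulr_gt0.
have fV z : `|f z - mu| <= V.
  by rewrite (le_trans (ler_normB _ _))// /V mulr_natl mulr2n lerD.
have mR0 : 0 < m%:R :> R by rewrite ltr0n.
(* For such large [t] the event is empty, each centered term being at most [V]. *)
have [tV|tV] := ltP (2 * V) t.
  rewrite [X in P X](_ : _ = set0) ?measure0 ?lee_fin ?expR_ge0//.
  apply/seteqP; split=> // w /=; rewrite leNgt => /negP[].
  apply: (@le_lt_trans _ _ (m%:R * V)); last by rewrite ltr_pM2l//; lra.
  rewrite mulr_natl -[X in _ *+ X](card_ord m) -sumr_const ler_sum// => j _.
  exact: le_trans (ler_norm _) (fV _).
(* [l] minimizes [2 (l V)^2 - l t]; for [t <= 2 V] it stays in the range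
   [l V <= 1/2] where [expR x <= 1 + x + 2 x^2] applies. *)
pose l := t / (4 * V ^+ 2).
have V20 : 0 < V ^+ 2 by rewrite exprn_gt0.
have l0 : 0 <= l by rewrite divr_ge0 ?(ltW t0)// mulr_ge0// ltW.
have lV : l * V <= 2^-1.
  rewrite /l mulrAC ler_pdivrMr ?mulr_gt0// expr2.
  have -> : 2^-1 * (4 * (V * V)) = (2 * V) * V by field.
  by rewrite ler_pM2r.
pose G z := expR (l * (f z - mu)).
have mG : measurable_fun setT G.
  apply: measurableT_comp => //; apply: measurable_funM => //.
  exact: measurable_funB.
have G0 z : 0 <= G z by exact: expR_ge0.
have GK z : 0 <= G z <= expR 1.
  rewrite G0 ler_expR /= (le_trans (ler_norm _))// normrM ger0_norm//.
  rewrite (le_trans (ler_wpM2l l0 (fV z)))// (le_trans lV)//; lra.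
have intG j : (\int[P]_w (G (Z j w))%:E = \int[rho]_z (G z)%:E)%E.
  rewrite -(@ge0_integral_distribution _ _ _ _ _ P (Z j) (EFin \o G))//;
    last exact/measurable_EFinP.
  by apply: eq_measure_integral => D mD _; exact: law.
have Gle : fine (\int[rho]_z (G z)%:E) <= expR (2 * (l * V) ^+ 2).
  rewrite -lee_fin fineK; first exact: exp_moment fM fV l0 lV.
  apply: integrable_fin_num => //; apply: (@bounded_integrable G (expR 1)) => //.
  by move=> z; have /andP[] := GK z; rewrite ger0_norm.
have mS : measurable_fun setT (fun w => \sum_(j < m) (f (Z j w) - mu)).
  apply: measurable_sum => j; apply: measurable_funB => //.
  exact: measurableT_comp.
have prodE w : \prod_(j < m) G (Z j w) = expR (l * \sum_(j < m) (f (Z j w) - mu)).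
  by rewrite mulr_sumr expR_sum.
have mA : measurable [set w | m%:R * t <= \sum_(j < m) (f (Z j w) - mu)].
  have := mS measurableT _ (measurable_itv `[m%:R * t, +oo[); rewrite setTI.
  congr measurable; apply/seteqP; split=> w /=; by rewrite in_itv/= andbT.
(* Chernoff's argument: the indicator of the event is below the rescaled exponential of the sum. *)
apply: (@le_trans _ _ (\int[P]_w (expR (- (l * (m%:R * t))) *
    \prod_(j < m) G (Z j w))%:E)%E).
  rewrite -[X in P X]setIT -integral_indic//.
  apply: ge0_le_integral => //.
  - by apply/measurable_EFinP; exact: measurable_indic.
  - apply/measurable_EFinP; apply: measurable_funM => //.
    by apply: measurable_prod => j _; exact: measurableT_comp.
  - move=> w _; rewrite lee_fin prodE -expRD indicE.
    case: (boolP (w \in _)) => [|_]; last exact: expR_ge0.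
    rewrite inE/= => h; rewrite -[leLHS]expR0 ler_expR addrC subr_ge0.
    by rewrite ler_wpM2l.
under eq_integral do rewrite EFinM.
rewrite ge0_integralZl_EFin ?expR_ge0//; last 2 first.
- by move=> w _; rewrite lee_fin prodr_ge0.
- by apply/measurable_EFinP; apply: measurable_prod => j _; exact: measurableT_comp.
rewrite (@integral_prod_indep _ _ _ _ _ _ _ Z (expR 1) mZ indep (fun=> G))//; last first.
  by rewrite -expR0 ler_expR.
rewrite -EFinM lee_fin.
under eq_bigr do rewrite intG.
rewrite prodr_const card_ord.
apply: (@le_trans _ _ (expR (- (l * (m%:R * t))) * expR (2 * (l * V) ^+ 2) ^+ m)).
  rewrite ler_wpM2l ?expR_ge0// lerXn2r// nnegrE ?expR_ge0//.
  by rewrite fine_ge0// integral_ge0// => z _; rewrite lee_fin.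
rewrite -expRM_natl -expRD ler_expR le_eqVlt; apply/orP; left; apply/eqP.
by rewrite /l /V; field; rewrite gt_eqF.
Qed.

End hoeffding.

(** * Measurability of distances in separable spaces *)

Section separable_measurability.
Context (R : realType).

Lemma continuous_measurable_realfun (V : normedModType R) (h : V -> R) :
  continuous h -> measurable_fun [set: borel V] (h : borel V -> R).
Proof.
move=> /continuousP ch; apply: (measurability _ (RGenOpens.measurableE R)) => //.
move=> _ [_ [a [b ->]] <-]; rewrite setTI; apply: sub_sigma_algebra.
exact/ch/interval_open.
Qed.

(** [|p - q| < a] holds exactly when [|p - v| + |q - v| < a] for some [v] in the countable dense
    set, so joint measurability of the pair for the Borel sets of the product is never invoked. *)
Lemma measurable_dist d (T : measurableType d) (V : normedModType R)
    (p q : T -> borel V) : separable V ->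
  measurable_fun setT p -> measurable_fun setT q ->
  measurable_fun setT (fun x => `|(p x : V) - (q x : V)|).
Proof.
move=> [D cD dD] mp mq.
have mdist (s : T -> borel V) (v : V) : measurable_fun setT s ->
    measurable_fun setT (fun x => `|(s x : V) - v|).
  move=> ms; apply: (@measurableT_comp _ _ _ _ _ _ (fun x : borel V => `|(x : V) - v|)) => //.
  apply: continuous_measurable_realfun => x.
  apply: cvg_norm; apply: cvgB => //; exact: cvg_cst.
apply: (measurability _ (RGenInftyO.measurableE R)) => //.
move=> _ [_ [a ->] <-]; rewrite setTI.
rewrite (_ : _ @^-1` _ = \bigcup_(v in D)
    [set x | `|(p x : V) - v| + `|(q x : V) - v| < a]).
  have mF v : measurable [set x | `|(p x : V) - v| + `|(q x : V) - v| < a].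
    have := measurable_funD (mdist p v mp) (mdist q v mq).
    move=> /(_ measurableT _ (measurable_itv `]-oo, a[)); rewrite setTI.
    by congr measurable; apply/seteqP; split=> x /=; rewrite in_itv.
  have [->|/surjfunPex[e ->]] := pfcard_geP cD; first by rewrite bigcup_set0.
  by rewrite bigcup_image; apply: bigcupT_measurable => n; exact: mF.
apply/seteqP; split=> x /=; rewrite in_itv/=.
  move=> pqa; have r0 : 0 < (a - `|(p x : V) - (q x : V)|) / 2.
    by rewrite divr_gt0// subr_gt0.
  have [|v [pv Dv]] := dD (ball (p x : V) ((a - `|(p x : V) - (q x : V)|) / 2)) _ (ball_open _ _).
    by exists (p x); exact: ballxx.
  exists v => //=; rewrite -ball_normE /ball_/= in pv.
  have : `|(q x : V) - v| <= `|(p x : V) - (q x : V)| + `|(p x : V) - v|.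
    rewrite (le_trans (ler_distD (p x : V) _ _))// lerD2r.
    by rewrite distrC.
  lra.
move=> [v Dv /=]; apply: le_lt_trans.
by rewrite (le_trans (ler_distD v _ _))// lerD2l distrC.
Qed.

End separable_measurability.

(** * Risk minimization for Lipschitz losses *)

Lemma lipschitz_argmin (R : realType) (V : normedModType R) (A : set V)
    (f : V -> R) (L : R) : A !=set0 -> compact A ->
  (forall a b, A a -> A b -> `|f a - f b| <= L * `|a - b|) ->
  argmin A f !=set0.
Proof.
move=> A0 cA fL.
have [a Aa amin] : exists2 a, A a & forall b, A b -> f a <= f b.
  by apply: compact_locally_lipschitz_min => // a Aa; exists L => b Ab _; exact: fL.
by exists a; split.
Qed.

Section risk_minimization.
Context (R : realType) d' (E : measurableType d') (rho : probability E R)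
  (V : normedModType R) (BB : set V) (loss : V -> E -> R) (M L : R).
Hypotheses (BB0 : BB !=set0) (cBB : compact BB)
  (mloss : forall B, BB B -> measurable_fun setT (loss B))
  (loss_ge0 : forall B z, BB B -> 0 <= loss B z)
  (loss_le : forall B z, BB B -> loss B z <= M)
  (loss_lip : forall B1 B2 z, BB B1 -> BB B2 ->
     `|loss B1 z - loss B2 z| <= L * `|B1 - B2|)
  (M0 : 0 < M) (L0 : 0 < L).

Definition risk B : R := fine (\int[rho]_z (loss B z)%:E)%E.

Definition emp_risk (m : nat) (z : 'I_m -> E) B : R :=
  m%:R^-1 * \sum_(j < m) loss B (z j).

Let loss_norm B z : BB B -> `|loss B z| <= M.
Proof. by move=> BBB; rewrite ger0_norm ?loss_le// loss_ge0. Qed.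

Lemma risk_integrable B : BB B -> rho.-integrable setT (EFin \o loss B).
Proof.
move=> BBB; apply: (@bounded_integrable _ _ _ rho _ M); first exact: mloss.
by move=> z; exact: loss_norm.
Qed.

Lemma risk_lipschitz B1 B2 : BB B1 -> BB B2 ->
  `|risk B1 - risk B2| <= L * `|B1 - B2|.
Proof.
move=> b1 b2; have i1 := risk_integrable b1; have i2 := risk_integrable b2.
have -> : risk B1 - risk B2 = Rintegral rho setT (fun z => loss B1 z - loss B2 z).
  by rewrite RintegralB.
have ib : rho.-integrable setT (EFin \o (fun z => loss B1 z - loss B2 z)).
  apply: (@bounded_integrable _ _ _ rho _ (L * `|B1 - B2|)) => [|z]; last exact: loss_lip.
  by apply: measurable_funB; exact: mloss.
rewrite (le_trans (le_normr_Rintegral _ _))//.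
have -> : L * `|B1 - B2| = Rintegral rho setT (fun=> L * `|B1 - B2|).
  rewrite Rintegral_cst// [X in fine X](_ : _ = 1%E) ?mulr1//.
  exact: probability_setT.
apply: le_Rintegral => //.
- exact: integrable_norm.
- exact: finite_measure_integrable_cst.
- by move=> z _; exact: loss_lip.
Qed.

Lemma emp_risk_lipschitz m (z : 'I_m -> E) B1 B2 : (0 < m)%N -> BB B1 -> BB B2 ->
  `|emp_risk z B1 - emp_risk z B2| <= L * `|B1 - B2|.
Proof.
move=> m0 b1 b2; rewrite -mulrBr normrM ger0_norm ?invr_ge0//.
rewrite ler_pdivrMl ?ltr0n// -sumrB (le_trans (ler_norm_sum _ _ _))//.
rewrite mulr_natl -[X in _ *+ X](card_ord m) -sumr_const ler_sum// => j _.
exact: loss_lip.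
Qed.

Lemma risk_argmin : argmin BB risk !=set0.
Proof. by apply: (lipschitz_argmin (L := L)) => // a b; exact: risk_lipschitz. Qed.

Lemma emp_risk_argmin m (z : 'I_m -> E) : (0 < m)%N -> argmin BB (emp_risk z) !=set0.
Proof.
by move=> m0; apply: (lipschitz_argmin (L := L)) => // a b; exact: emp_risk_lipschitz.
Qed.

Section sample.
Context d (Om : measurableType d) (P : probability Om R) (m : nat)
  (Z : 'I_m -> {RV P >-> E}).
Hypotheses (m0 : (0 < m)%N) (iid : iid_sample Z rho).

Let deviation (f : E -> R) (t : R) :=
  [set w | m%:R * t <= \sum_(j < m) (f (Z j w) - fine (\int[rho]_z (f z)%:E)%E)].

Let measurable_deviation f t : measurable_fun setT f -> measurable (deviation f t).
Proof.
move=> mf; have mS : measurable_fun setT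
    (fun w => \sum_(j < m) (f (Z j w) - fine (\int[rho]_z (f z)%:E)%E)).
  by apply: measurable_sum => j; apply: measurable_funB => //; exact: measurableT_comp.
have := mS measurableT _ (measurable_itv `[m%:R * t, +oo[); rewrite setTI.
by congr measurable; apply/seteqP; split=> w /=; rewrite in_itv/= andbT.
Qed.

Let deviationN_integral B : BB B ->
  fine (\int[rho]_z (- loss B z)%:E)%E = - risk B.
Proof.
move=> BBB; have -> : (fun z => (- loss B z)%:E) = (fun z => - (loss B z)%:E)%E by [].
by rewrite integralN ?fineN//; exact/integrable_add_def/risk_integrable.
Qed.

Lemma deviation_small B t w : BB B ->
  ~ deviation (loss B) t w -> ~ deviation (fun z => - loss B z) t w ->
  `|emp_risk (fun j => Z j w) B - risk B| <= t.
Proof.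
move=> BBB /negP; rewrite -ltNge => h1 /negP; rewrite -ltNge deviationN_integral// => h2.
have mR : 0 < m%:R :> R by rewrite ltr0n.
have E1 : \sum_(j < m) (loss B (Z j w) - risk B) =
    m%:R * (emp_risk (fun j => Z j w) B - risk B).
  rewrite sumrB sumr_const card_ord mulrBr /emp_risk mulVKf ?gt_eqF//.
  by rewrite mulr_natl.
have E2 : \sum_(j < m) (- loss B (Z j w) - - risk B) =
    - (m%:R * (emp_risk (fun j => Z j w) B - risk B)).
  by rewrite -E1 -sumrN; apply: eq_bigr => j _; rewrite opprB opprK addrC.
move: h1 h2; rewrite E1 E2 ltr_pM2l// -mulrN ltr_pM2l// => h1 h2.
by rewrite ler_norml; apply/andP; split; lra.
Qed.

(** The event [F] is fixed before [Bhat] and serves every empirical minimizer at once, so [Bhat] may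
    depend on the sample in a non-measurable way. *)
Lemma generalization_bound (eta : R) : 0 < eta ->
  exists F, [/\ measurable F,
    (forall w, F w -> forall Bhat Bstar,
       argmin BB (emp_risk (fun j => Z j w)) Bhat -> BB Bstar ->
       risk Bhat - risk Bstar <= eta)
  & (1 - 2%:E * covering_number BB ((16 * L)^-1 * eta) *
      (expR (- (512 * M ^+ 2)^-1 * m%:R * eta ^+ 2))%:E <= P F)%E].
Proof.
move=> eta0; set r := _ * eta; set e := expR _.
pose S := [set n : nat | exists c : 'I_n -> V, BB `<=` \bigcup_j ball (c j) r].
(* With no finite covering the covering number is [+oo] and the lower bound is [-oo]: the empty
   event suffices. *)
have [S0|S0] := pselect (S !=set0); last first.
  exists set0; split=> //.
  have -> : covering_number BB r = +oo%E.
    rewrite /covering_number -/S (_ : S = set0) ?image_set0 ?ereal_inf0//.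
    by apply/seteqP; split=> // n Sn; apply: S0; exists n.
  by rewrite gt0_muley// gt0_mulye ?lte_fin ?expR_gt0// addeNy leNye.
have exS : exists n, `[< S n >] by case: S0 => n Sn; exists n; exact/asboolP.
pose n := ex_minn exS.
have [c cover nmin] : exists2 c : 'I_n -> V, BB `<=` \bigcup_j ball (c j) r &
    forall k, S k -> (n <= k)%N.
  rewrite /n; case: ex_minnP => k /asboolP[c cP] kmin; exists c => // l Sl.
  by apply: kmin; exact/asboolP.
have nN : (n%:R%:E <= covering_number BB r)%E.
  apply: le_ereal_inf_tmp => _ [k Sk <-]; rewrite lee_fin ler_nat; exact: nmin.
have [B0 B0P] := BB0.
(* Centres may lie outside [BB], where nothing is known of the loss. A ball meeting [BB] is
   represented by one of its points in [BB], which doubles the radius; every other index gets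
   [B0]. *)
have /choice[rep repP] : forall k : nat, exists B, BB B /\
    forall i : 'I_n, i = k :> nat -> forall B', BB B' -> ball (c i) r B' -> `|B' - B| <= 2 * r.
  move=> k; have [kn|nk] := ltnP k n; last first.
    by exists B0; split=> // i ik; move: (ltn_ord i); rewrite ik ltnNge nk.
  have [[B [BBB Bc]]|none] := pselect (exists B, BB B /\ ball (c (Ordinal kn)) r B).
    exists B; split=> // i ik B' BBB' B'c.
    have ik' : i = Ordinal kn by exact/val_inj.
    rewrite ik' in B'c; rewrite -ball_normE /ball_/= in Bc B'c.
    rewrite mulr_natl mulr2n (le_trans (ler_distD (c (Ordinal kn)) _ _))// lerD//.
      by rewrite distrC ltW.
    exact: ltW.
  exists B0; split=> // i ik B' BBB' B'c; exfalso; apply: none; exists B'; split=> //.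
  by have <- : i = Ordinal kn by exact/val_inj.
(* [B] is within [eta / (8 L)] of the representative [rep i] of its ball, so a
   deviation of [eta / 4] at [rep i] is one of at most [eta / 2] at [B]. *)
pose t := eta / 4; have t0 : 0 < t by rewrite divr_gt0.
pose bad k := deviation (loss (rep k)) t `|` deviation (fun z => - loss (rep k) z) t.
have mbad k : measurable (bad k).
  have mk := mloss (repP k).1.
  apply: measurableU; apply: measurable_deviation => //.
  exact: measurableT_comp.
have Pbad k : (P (bad k) <= (2 * e)%:E)%E.
  have mk := mloss (repP k).1.
  have tail (f : E -> R) : measurable_fun setT f -> (forall z, `|f z| <= M) ->
      (P (deviation f t) <= e%:E)%E.
    move=> mf fM; apply: le_trans (hoeffding_tail m0 _ iid.2 mf M0 fM t0) _.
      by move=> j D mD; exact: iid.1.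
    (* With [t = eta / 4] the denominator [32 M^2] becomes [512 M^2]. *)
    rewrite lee_fin ler_expR le_eqVlt; apply/orP; left; apply/eqP.
    by rewrite /t; field; rewrite gt_eqF.
  apply: (le_trans (measureU2 _ _ _)).
  - exact: measurable_deviation.
  - by apply: measurable_deviation; exact: measurableT_comp.
  - rewrite mulr_natl mulr2n EFinD leeD// tail//.
    + by move=> z; apply: loss_norm; exact: (repP k).1.
    + exact: measurableT_comp.
    + by move=> z; rewrite normrN; apply: loss_norm; exact: (repP k).1.
pose U := \big[setU/set0]_(k < n) bad k.
have mU : measurable U by apply: bigsetU_measurable.
have PU : (P U <= (2 * n%:R * e)%:E)%E.
  apply: (@le_trans _ _ (\sum_(k < n) P (bad k))%E).
    by apply: Boole_inequality => k _; exact: mbad.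
  apply: (@le_trans _ _ (\sum_(k < n) (2 * e)%:E)%E).
    by apply: lee_sum => k _; exact: Pbad.
  rewrite sumEFin lee_fin sumr_const card_ord -mulr_natr; lra.
exists (~` U); split; first exact: measurableC.
- move=> w Uw Bhat Bstar [bhat hmin] bstar.
  have close B : BB B -> `|emp_risk (fun j => Z j w) B - risk B| <= eta / 2.
    move=> BBB; have [i _ Bi] := cover _ BBB.
    have [repB repi] := repP i; have dist := repi i erefl _ BBB Bi.
    have nbad : ~ bad i w.
      move=> badi; apply: Uw; rewrite /U -bigcup_mkord.
      by exists (i : nat) => //=.
    have h := deviation_small repB (fun h => nbad (or_introl h)) (fun h => nbad (or_intror h)).
    have h1 := emp_risk_lipschitz (fun j => Z j w) m0 BBB repB.
    have h2 := risk_lipschitz BBB repB.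
    have h3 : L * `|B - rep i| <= eta / 8.
      apply: (le_trans (ler_wpM2l (ltW L0) dist)).
      by rewrite /r le_eqVlt; apply/orP; left; apply/eqP; field; rewrite gt_eqF.
    have {}h1 := le_trans h1 h3; have {}h2 := le_trans h2 h3.
    move: h h1 h2; rewrite /t !ler_norml => /andP[a1 a2] /andP[b1 b2] /andP[c1 c2].
    by apply/andP; split; lra.
  have := close _ bhat; have := close _ bstar; have := hmin _ bstar.
  rewrite !ler_norml => a /andP[b1 b2] /andP[c1 c2]; lra.
- rewrite probability_setC//.
  apply: (@le_trans _ _ (1 - (2 * n%:R * e)%:E)%E); last by rewrite leeB.
  rewrite leeB// !EFinM lee_wpmul2r ?lee_fin ?expR_ge0// lee_wpmul2l//.
Qed.

End sample.
End risk_minimization.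

(** * The reconstruction map *)

Lemma locally_lipschitz_continuous (R : realType) (V W : normedModType R)
    (f : V -> W) (x : V) (L : R) : 0 <= L ->
  (forall z, `|x - z| <= 1 -> `|f x - f z| <= L * `|x - z|) ->
  {for x, continuous f}.
Proof.
move=> L0 lip; apply/cvgrPdist_lt => e e0; near=> z.
have : ball x (Num.min 1 (e / (L + 1))) z.
  by near: z; apply: nbhsx_ballx; rewrite lt_min ltr01 divr_gt0// ltr_wpDl.
rewrite -ball_normE /ball_/= lt_min => /andP[/ltW xz1 xz2].
apply: (le_lt_trans (lip _ xz1)); move: xz2; rewrite ltr_pdivlMr ?ltr_wpDl//.
by apply: le_lt_trans; rewrite mulrC ler_wpM2l// lerDl.
Unshelve. all: by end_near. Qed.

Lemma continuous_boundedLinear (R : realType) (V W : normedModType R)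
    (f : 'L(V, W)) : continuous f.
Proof.
by move=> x; apply: (locally_lipschitz_continuous (normr_ge0 f)) => z _; rewrite -mapLB ler_opnorm.
Qed.

Lemma inv_opK (R : realType) (U V : normedModType R) (f : U -> V) u :
  injective f -> inv_op f (f u) = u.
Proof. by move=> injf; apply: injf; apply: (@xgetPex _ 0 [set w | f w = f u]); exists u. Qed.

Lemma range_inv_op (R : realType) (U V : normedModType R) (f : U -> V) v :
  range f v -> f (inv_op f v) = v.
Proof. by move=> [u _ fu]; apply: (@xgetPex _ 0 [set w | f w = v]); exists u. Qed.

Lemma covariance_operator_sym_psd (R : realType) (H : hilbertType R) d
    (Om : measurableType d) (P : probability Om R) (Z : {RV P >-> borel H})
    (S : 'L(H, H)) : is_covariance_operator Z S ->
  (forall u v, dotp (S u) v = dotp u (S v)) /\ (forall u, 0 <= dotp (S u) u).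
Proof.
move=> cov; split=> u; last by rewrite -lee_fin cov; exact: variance_ge0.
by move=> v; apply: EFin_inj; rewrite cov (dotpC u) cov covarianceC.
Qed.

Section reconstruction_lipschitz.
Context (R : realType) (X Y : hilbertType R) (A : 'L(X, Y)) (Sigma : 'L(Y, Y))
  (BB : set 'L(l2 R, X)).
Hypotheses (symS : forall u v, dotp (Sigma u) v = dotp u (Sigma v))
  (psdS : forall u, 0 <= dotp (Sigma u) u)
  (injS : injective Sigma) (compat : compatible A Sigma)
  (BB0 : BB !=set0) (cBB : compact BB)
  (fbi : forall B, BB B -> finite_basis_injective (A \o B)).

Let K : 'L(X, Y) := compactL compat.2.

Let KE x : Sigma (K x) = A x.
Proof. by rewrite compactLE range_inv_op//; apply: compat.1; exists x. Qed.

(** [A = Sigma K = Q (Q K)], so [inv_op Q] removes the outer [Q], which is injective because its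
    square [Sigma] is. The default value of [inv_op] off the range is never met. *)
Lemma objective_lasso B y :
  objective A Sigma B y = lasso (sqrt_op Sigma) (compL K B) y.
Proof.
have [_ _ QQ] := sqrt_op_spec symS psdS.
have injQ : injective (sqrt_op Sigma).
  by move=> u v uv; apply: injS; rewrite -!QQ uv.
apply/funext => u; rewrite /objective /lasso /lasso_smooth compLE.
by rewrite -{1}(KE (B u)) -QQ inv_opK//
  -[inv_op Sigma _]/((fun x => inv_op Sigma (A x)) (B u)) -(compactLE compat.2).
Qed.

(** [xget] may return any minimizer: one exists by [lasso_argmin_uniform], and
    [lasso_argmin_lipschitz] holds for every choice. With equal data it even gives uniqueness. *)
Lemma reconstruct_lipschitz (r : R) : 0 <= r -> exists L M, [/\ 0 <= L, 0 <= M,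
  (forall B y, BB B -> `|y| <= r -> `|reconstruct A Sigma B y| <= M) &
  (forall B1 B2 y1 y2, BB B1 -> BB B2 -> `|y1| <= r -> `|y2| <= r ->
    `|reconstruct A Sigma B1 y1 - reconstruct A Sigma B2 y2| <=
    L * (`|B1 - B2| + `|y1 - y2|))].
Proof.
move=> r0; have [symQ _ QQ] := sqrt_op_spec symS psdS.
have cK : compact_operator K.
  by have := compat.2; congr compact_operator; apply/funext => x; rewrite compactLE.
have fbi' B : BB B -> finite_basis_injective (Sigma \o K \o B).
  by move=> /fbi; congr finite_basis_injective; apply/funext => u /=; rewrite KE.
have [n [N uniq]] := lasso_argmin_uniform symS psdS injS symQ QQ cK cBB r0.
have [L [M [L0 M0 lip]]] := lasso_argmin_lipschitz symS psdS injS symQ QQ cK cBB BB0 fbi' r0.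
have [b b0 bP] := compact_norm_bounded cBB.
pose rec (B : 'L(l2 R, X)) y := xget 0 (argmin setT (lasso (sqrt_op Sigma) (compL K B) y)).
have recE B y : reconstruct A Sigma B y = B (rec B y).
  by rewrite /reconstruct objective_lasso.
have recP B y : BB B -> `|y| <= r ->
    argmin setT (lasso (sqrt_op Sigma) (compL K B) y) (rec B y).
  by move=> BBB yr; apply: xgetPex; exact: (uniq _ BBB _ yr).1.
exists (b * L + M), (b * M); split.
- by rewrite addr_ge0// mulr_ge0.
- by rewrite mulr_ge0.
- move=> B y BBB yr; rewrite recE (le_trans (ler_opnorm _ _))// ler_pM//; first exact: bP.
  have := recP _ _ BBB yr => h.
  by have [] := lip _ _ _ _ _ _ BBB BBB yr yr h h.
- move=> B1 B2 y1 y2 b1 b2 y1r y2r; rewrite !recE.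
  have [u1M u12] := lip _ _ _ _ _ _ b1 b2 y1r y2r (recP _ _ b1 y1r) (recP _ _ b2 y2r).
  have [u2M _] := lip _ _ _ _ _ _ b2 b1 y2r y1r (recP _ _ b2 y2r) (recP _ _ b1 y1r).
  have -> : B1 (rec B1 y1) - B2 (rec B2 y2) =
      B2 (rec B1 y1 - rec B2 y2) + (B1 - B2) (rec B1 y1).
    by rewrite mapLB subLE [RHS]addrC addrA subrK.
  rewrite (le_trans (ler_normD _ _))// mulrDl lerD//.
    by rewrite (le_trans (ler_opnorm _ _))// -mulrA ler_pM// bP.
  rewrite (le_trans (ler_opnorm _ _))// mulrC ler_pM//.
  by rewrite lerDl.
Qed.

(** The Lipschitz constant depends on the radius, so it is taken for [|y| + 1], which covers the
    unit ball around [y]. *)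
Lemma continuous_reconstruct B : BB B -> continuous (reconstruct A Sigma B).
Proof.
move=> BBB y; have [|L [M [L0 M0 _ lip]]] := @reconstruct_lipschitz (`|y| + 1).
  by rewrite addr_ge0.
apply: (locally_lipschitz_continuous L0) => z yz.
have := lip B B y z BBB BBB; rewrite subrr normr0 add0r; apply; first by rewrite lerDl.
by rewrite -lerBlDl (le_trans (lerB_dist _ _))// distrC.
Qed.

End reconstruction_lipschitz.

(** * Losses truncated to the range of the data *)

Lemma continuous_measurable_borel (R : realType) (T U : normedModType R) (f : T -> U) :
  continuous f -> measurable_fun [set: borel T] (f : borel T -> borel U).
Proof.
move=> /continuousP cf; apply: (@measurability _ _ (borel T) (borel U) setT f (@open U) erefl).
by move=> _ [D oD <-]; rewrite setTI; apply: sub_sigma_algebra; exact: cf.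
Qed.

Lemma measurable_sq_error (R : realType) (X Y : hilbertType R) (A : 'L(X, Y))
    (Sigma : 'L(Y, Y)) (B : 'L(l2 R, X)) : separable X ->
  continuous (reconstruct A Sigma B) -> measurable_fun setT (sq_error A Sigma B).
Proof.
move=> sepX cont; apply: measurable_funX.
apply: (@measurable_dist _ _ _ _
  (fun z : borel X * borel Y => (reconstruct A Sigma B z.2 : borel X)) fst) => //.
apply: (@measurableT_comp _ _ _ _ _ _ (reconstruct A Sigma B : borel Y -> borel X)) => //.
exact: continuous_measurable_borel.
Qed.

Section bounded_data.
Context (R : realType) (X Y : hilbertType R) (A : 'L(X, Y)) (Sigma : 'L(Y, Y))
  (BB : set 'L(l2 R, X)) (Q0 r M L : R).
Hypotheses (sepX : separable X) (sepY : separable Y)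
  (rec_le : forall B y, BB B -> `|y| <= r -> `|reconstruct A Sigma B y| <= M)
  (rec_lip : forall B1 B2 y, BB B1 -> BB B2 -> `|y| <= r ->
     `|reconstruct A Sigma B1 y - reconstruct A Sigma B2 y| <= L * `|B1 - B2|)
  (rec_cont : forall B, BB B -> continuous (reconstruct A Sigma B)).

Definition data_range : set (borel X * borel Y) :=
  [set z | `|z.1 : X| <= Q0 /\ `|z.2 : Y| <= r].

(* The error is bounded and Lipschitz in B only on the range of the data. *)
Definition truncated_loss B (z : borel X * borel Y) : R :=
  sq_error A Sigma B z * \1_data_range z.

Lemma measurable_closed_norm_ball (V : normedModType R) (a : R) :
  measurable [set v : borel V | `|v : V| <= a].
Proof.
have cn : continuous (fun v : V => `|v|) by move=> v; exact: cvg_norm.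
have := continuous_measurable_realfun cn measurableT (measurable_itv `]-oo, a]).
by rewrite setTI; congr measurable; apply/seteqP; split=> v /=; rewrite in_itv.
Qed.

Lemma measurable_data_range : measurable data_range.
Proof.
rewrite (_ : data_range =
  [set v : borel X | `|v : X| <= Q0] `*` [set v : borel Y | `|v : Y| <= r])//.
by apply: measurableX; exact: measurable_closed_norm_ball.
Qed.

Lemma measurable_truncated_loss B : BB B -> measurable_fun setT (truncated_loss B).
Proof.
move=> BBB; apply: measurable_funM.
  by apply: measurable_sq_error => //; exact: rec_cont.
by apply: measurable_indic; exact: measurable_data_range.
Qed.

Lemma truncated_loss_ge0 B z : BB B -> 0 <= truncated_loss B z.
Proof. by move=> _; rewrite mulr_ge0// sqr_ge0. Qed.

Lemma truncated_lossE B z : data_range z -> truncated_loss B z = sq_error A Sigma B z.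
Proof. by move=> zG; rewrite /truncated_loss indicE mem_set// mulr1. Qed.

Let reconstruction_error_le B z : BB B -> data_range z ->
  `|reconstruct A Sigma B z.2 - z.1| <= M + Q0.
Proof.
by move=> BBB [z1 z2]; rewrite (le_trans (ler_normB _ _))// lerD// rec_le.
Qed.

Lemma truncated_loss_le B z : BB B -> truncated_loss B z <= (M + Q0) ^+ 2.
Proof.
move=> BBB; have [zG|zG] := pselect (data_range z); last first.
  by rewrite /truncated_loss indicE memNset// mulr0 sqr_ge0.
have h := reconstruction_error_le BBB zG.
by rewrite truncated_lossE// /sq_error lerXn2r ?nnegrE// (le_trans _ h).
Qed.

Lemma truncated_loss_lipschitz B1 B2 z : 0 <= L -> 0 <= M + Q0 -> BB B1 -> BB B2 ->
  `|truncated_loss B1 z - truncated_loss B2 z| <= 2 * (M + Q0) * L * `|B1 - B2|.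
Proof.
move=> L0 MQ b1 b2; have [zG|zG] := pselect (data_range z); last first.
  by rewrite /truncated_loss indicE memNset// !mulr0 subrr normr0 !mulr_ge0.
have h1 := reconstruction_error_le b1 zG; have h2 := reconstruction_error_le b2 zG.
rewrite !truncated_lossE// /sq_error subr_sqr normrM mulrC -mulrA ler_pM//.
  rewrite (le_trans (ler_normD _ _))// !normr_id; lra.
rewrite (le_trans (ler_dist_dist _ _))// opprB addrA subrK.
by apply: rec_lip => //; case: zG.
Qed.

Lemma expected_loss_risk (rho : probability (borel X * borel Y)%type R) B :
  rho (~` data_range) = 0%E -> BB B ->
  expected_loss A Sigma rho B = (risk rho truncated_loss B)%:E.
Proof.
move=> rho0 BBB; have mG := measurable_data_range.
have mt := measurable_truncated_loss BBB.
have int : rho.-integrable setT (EFin \o truncated_loss B).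
  apply: (@bounded_integrable _ _ _ rho _ ((M + Q0) ^+ 2)) => // z.
  by rewrite ger0_norm ?truncated_loss_le ?truncated_loss_ge0.
rewrite /expected_loss unlock /risk fineK; last exact: integrable_fin_num.
apply: ae_eq_integral => //.
- apply/measurable_EFinP; apply: measurable_sq_error => //; exact: rec_cont.
- exact/measurable_EFinP.
- exists (~` data_range); split=> //; first exact: measurableC.
  by move=> z /= h zG; apply: h => _; rewrite truncated_lossE.
Qed.

Lemma empirical_loss_risk m (z : 'I_m -> borel X * borel Y) B :
  (forall j, data_range (z j)) ->
  empirical_loss A Sigma z B = emp_risk truncated_loss z B.
Proof.
move=> zG; rewrite /empirical_loss /emp_risk; congr (_ * _).
by apply: eq_bigr => j _; rewrite truncated_lossE.
Qed.

Lemma law_data_range d (Om : measurableType d) (P : probability Om R)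
    (x : {RV P >-> borel X}) (eps : {RV P >-> borel Y})
    (rho : probability (borel X * borel Y)%type R) :
  {ae P, forall w, `|x w : X| <= Q0} ->
  {ae P, forall w, `|A (x w) + eps w : Y| <= r} ->
  has_law P (fun w => (x w, A (x w) + eps w) : borel X * borel Y) rho ->
  rho (~` data_range) = 0%E.
Proof.
move=> aex aey law; have mG := measurableC measurable_data_range.
rewrite -law// /pushforward.
have mx := measurable_closed_norm_ball (V := X) Q0.
have my : measurable_fun setT (fun w => `|A (x w) + eps w : Y|).
  have mA : measurable_fun setT ((A : borel X -> borel Y) \o x).
    apply: measurableT_comp => //; apply: continuous_measurable_borel.
    exact: continuous_boundedLinear.
  (* [A x + eps] is written as the difference of [A x] and [- eps], so that [measurable_dist] gives
     the measurability of its norm. *)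
  have mN : measurable_fun setT ((fun y : borel Y => - (y : Y) : borel Y) \o eps).
    apply: measurableT_comp => //.
    by apply: (@continuous_measurable_borel _ Y Y -%R); exact: opp_continuous.
  have := measurable_dist sepY mA mN.
  by congr measurable_fun; apply/funext => w /=; rewrite opprK.
apply/negligibleP.
  rewrite -preimage_setC; apply: measurableC.
  rewrite (_ : _ @^-1` _ = [set: Om] `&` x @^-1` [set v : borel X | `|v : X| <= Q0] `&`
      ([set: Om] `&` (fun w => `|A (x w) + eps w : Y|) @^-1` `]-oo, r])).
    by apply: measurableI; [exact: measurable_funPT|exact: my].
  by rewrite !setTI; apply/seteqP; split=> w; rewrite /data_range /= in_itv.
apply: filterS2 aex aey => w h1 h2.
by split.
Qed.

End bounded_data.

Lemma iid_sample_ae (R : realType) d d' (Om : measurableType d) (E : measurableType d')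
    (P : probability Om R) m (z : 'I_m -> {RV P >-> E}) (rho : probability E R)
    (G : set E) : measurable G -> rho (~` G) = 0%E -> iid_sample z rho ->
  {ae P, forall w, forall j, G (z j w)}.
Proof.
move=> mG rhoG [law _]; apply: filter_forall => j.
exists (z j @^-1` (~` G)); split=> //.
- exact: measurable_funPTI (measurableC mG).
- by rewrite -rhoG -(law j)//; exact: measurableC.
Qed.

(** [D] need not be measurable: removing from [F] a measurable null set that contains the failures
    of [Q] leaves a measurable part of [D] without loss of probability. *)
Lemma prob_ge_ae (R : realType) d (Om : measurableType d) (P : probability Om R)
    (F : set Om) (Q : Om -> Prop) (D : set Om) (p : \bar R) :
  measurable F -> {ae P, forall w, Q w} -> (forall w, F w -> Q w -> D w) ->
  (p <= P F)%E -> prob_ge P D p.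
Proof.
move=> mF [N [mN PN QN]] FQD pF; exists (F `\` N).
  split; first exact: measurableD.
  move=> w [Fw Nw]; apply: FQD => //; apply: contrapT => nQ; exact/Nw/QN.
apply: (le_trans pF).
rewrite -[leRHS]adde0 -PN; apply: le_trans (measureU2 _ _ _) => //; last exact: measurableD.
apply: le_measure; rewrite ?inE//; first by apply: measurableU => //; exact: measurableD.
by move=> w Fw; have [?|?] := pselect (N w); [right|left].
Qed.

Theorem theorem3p2 (R : realType) (X Y : hilbertType R)
    (sepX : separable X) (sepY : separable Y)
    (A : 'L(X, Y)) (Sigma : 'L(Y, Y)) (Q0 : R) (BB : set 'L(l2 R, X))
    (inj_Sigma : injective Sigma)
    (compat : compatible A Sigma)
    (Q0_gt0 : 0 < Q0)
    (BB0 : BB !=set0) (cBB : compact BB)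
    (fbi : forall B, BB B -> finite_basis_injective (A \o B)) :
  exists C C' : R, [/\ 0 < C, 0 < C' &
  forall (d : measure_display) (Om : measurableType d) (P : probability Om R)
    (x : {RV P >-> borel X}) (eps : {RV P >-> borel Y})
    (rho : probability (borel X * borel Y)%type R),
  square_integrable x ->
  square_integrable eps ->
  zero_mean eps ->
  independent_RV x eps ->
  is_covariance_operator eps Sigma ->
  {ae P, forall w, `|x w : X| <= Q0} ->
  {ae P, forall w, `|eps w : Y| <= Q0} ->
  has_law P (fun w => (x w, A (x w) + eps w) : borel X * borel Y) rho ->
  (exists Bstar, argmin BB (expected_loss A Sigma rho) Bstar) /\
  forall (m : nat) (d' : measure_display) (Om' : measurableType d')
    (P' : probability Om' R) (z : 'I_m -> {RV P' >-> (borel X * borel Y)%type}),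
  (0 < m)%N ->
  iid_sample z rho ->
  {ae P', forall w, exists Bhat,
    argmin BB (empirical_loss A Sigma (fun j => z j w)) Bhat} /\
  forall (Bstar : 'L(l2 R, X)) (Bhat : Om' -> 'L(l2 R, X)),
  argmin BB (expected_loss A Sigma rho) Bstar ->
  {ae P', forall w,
    argmin BB (empirical_loss A Sigma (fun j => z j w)) (Bhat w)} ->
  forall eta : R, 0 < eta ->
  prob_ge P'
    [set w | (expected_loss A Sigma rho (Bhat w) -
              expected_loss A Sigma rho Bstar <= eta%:E)%E]
    (1 - 2%:E * covering_number BB (C * eta) *
         (expR (- C' * m%:R * eta ^+ 2))%:E)%E].

Proof.
(* Sigma is known to be symmetric and positive only once a noise eps is given,
   whereas the constants must be chosen before; otherwise no eps exists. *)
have [[symS psdS]|nsp] := pselect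
    ((forall u v, dotp (Sigma u) v = dotp u (Sigma v)) /\
     (forall u, 0 <= dotp (Sigma u) u)); last first.
  exists 1, 1; split=> // d Om P x eps rho _ _ _ _ /covariance_operator_sym_psd cov.
  by exfalso; exact: nsp.
(* This bounds [y = A x + eps] almost surely. *)
pose r := `|A| * Q0 + Q0.
have r0 : 0 <= r by rewrite addr_ge0 ?mulr_ge0// ltW.
have [L [M [L0 M0 recM recL]]] :=
  reconstruct_lipschitz symS psdS inj_Sigma compat BB0 cBB fbi r0.
have rec_cont B : BB B -> continuous (reconstruct A Sigma B).
  by move=> BBB; exact (continuous_reconstruct symS psdS inj_Sigma compat BB0 cBB fbi BBB).
(* [L] is only known to be nonnegative, while the Lipschitz constant of the loss has to be inverted
   in [C]. *)
pose L1 := L + 1; have L10 : 0 < L1 by rewrite ltr_wpDl.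
have rec_lip B1 B2 y : BB B1 -> BB B2 -> `|y| <= r ->
    `|reconstruct A Sigma B1 y - reconstruct A Sigma B2 y| <= L1 * `|B1 - B2|.
  move=> b1 b2 yr; rewrite (le_trans (recL _ _ _ _ b1 b2 yr yr))//.
  by rewrite subrr normr0 addr0 ler_wpM2r// lerDl.
have MQ0 : 0 < M + Q0 by rewrite ltr_wpDl.
pose loss := truncated_loss A Sigma Q0 r.
pose M2 := (M + Q0) ^+ 2; have M20 : 0 < M2 by rewrite exprn_gt0.
pose L2 := 2 * (M + Q0) * L1; have L20 : 0 < L2 by rewrite !mulr_gt0.
have mloss B : BB B -> measurable_fun setT (loss B).
  exact: measurable_truncated_loss.
have loss_ge0 B z : BB B -> 0 <= loss B z by exact: truncated_loss_ge0.
have loss_le B z : BB B -> loss B z <= M2 by exact: truncated_loss_le.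
have loss_lip B1 B2 z : BB B1 -> BB B2 -> `|loss B1 z - loss B2 z| <= L2 * `|B1 - B2|.
  exact (fun b1 b2 => truncated_loss_lipschitz recM rec_lip z (ltW L10) (ltW MQ0) b1 b2).
exists (16 * L2)^-1, (512 * M2 ^+ 2)^-1; split.
- by rewrite invr_gt0 mulr_gt0.
- by rewrite invr_gt0 mulr_gt0 ?ltr0n ?exprn_gt0.
move=> d Om P x eps rho _ _ _ _ _ aex aeeps law.
have rhoG : rho (~` data_range Q0 r) = 0%E.
  apply: (law_data_range sepY aex _ law).
  apply: filterS2 aex aeeps => w xw ew.
  rewrite (le_trans (ler_normD _ _))// lerD// (le_trans (ler_opnorm _ _))//.
  by rewrite ler_wpM2l.
have lossE B : BB B -> expected_loss A Sigma rho B = (risk rho loss B)%:E.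
  exact: (expected_loss_risk sepX recM rec_cont rhoG).
split.
  have [B [BBB Bmin]] := risk_argmin rho BB0 cBB mloss loss_ge0 loss_le loss_lip.
  exists B; split=> // B' BBB'; rewrite !lossE// lee_fin; exact: Bmin.
move=> m d' Om' P' z m0 iid.
have aeG := iid_sample_ae (measurable_data_range _ _) rhoG iid.
split.
  apply: filterS aeG => w zw.
  have [B [BBB Bmin]] := emp_risk_argmin BB0 cBB loss_lip (fun j => z j w) m0.
  exists B; split=> // B' BBB'; rewrite !(empirical_loss_risk _ _ _ zw); exact: Bmin.
move=> Bstar Bhat [bstar _] aehat eta eta0.
have [F [mF Fbound pF]] :=
  generalization_bound BB0 mloss loss_ge0 loss_le loss_lip M20 L20 m0 iid eta0.
apply: (prob_ge_ae mF (filterI aeG aehat) _ pF).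
move=> w Fw [zw [bhat hmin]].
rewrite /= !lossE// -EFinB lee_fin; apply: (Fbound _ Fw) => //; split=> // B BBB.
by rewrite -!(empirical_loss_risk _ _ _ zw); exact: hmin.
Qed.
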